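(* Let $\sigma=\sigma_1\cdots\sigma_n$ be a turn sequence with $l$ left turns and $r$ right turns, $l-r\ge 0$, such that some point of the $-x$-axis is reachable by $\sigma$. Then: (1) if $l-r=0$, then $|x^-_\sigma|\le 2$; (2) if $l-r=1$, then $|x^-_\sigma|\le {}_{-x}m^{p}_{+y}+1$; (3) if $l-r=2$ and $\sigma_n=\texttt{R}$, then $|x^-_\sigma|\le 2$; if $l-r=2$ and $\sigma_n=\texttt{L}$, then $|x^-_\sigma|\le {}_{-x}m^{p}_{+y}+2$; (4) if $l-r\ge 3$, then $|x^-_\sigma|\le\left\lfloor\frac{l-r+2}{4}\right\rfloor+1$ in case $\sigma_n=\texttt{R}$ and $l-r\equiv 2\pmod 4$, and $|x^-_\sigma|\le\left\lfloor\frac{l-r+2}{4}\right\rfloor$ otherwise.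
   Context: A turn sequence is a finite word $\sigma=\sigma_1\cdots\sigma_n$ with $\sigma_i\in\{\texttt{L},\texttt{R}\}$ (left turn, right turn). A rectilinear chain realizes $\sigma$ if it is simple (no self-intersection), consists of $n+1$ axis-parallel segments of positive integer length, starts at the origin $o=(0,0)$ with its first segment heading east (direction $+x$), and at its $n$ successive bends makes the $90^\circ$ turns $\sigma_1,\dots,\sigma_n$ in order. Its endpoint $p\in\mathbb{Z}^2$ is said to be reachable by $\sigma$. The $-x$-axis is $\{(a,0):a<0\}$. $(x^-_\sigma,0)$ denotes the point reachable by $\sigma$ on the $-x$-axis closest to $o$ (so $x^-_\sigma<0$). Directions: with $\delta_i=\#\texttt{L}-\#\texttt{R}$ among $\sigma_1,\dots,\sigma_i$ ($\delta_0=0$), the $(i+1)$st segment of any chain realizing $\sigma$, directed from $o$ towards the endpoint $p$, is a $+x$-, $+y$-, $-x$-, $-y$-segment (has that direction) according to $\delta_i\equiv 0,1,2,3\pmod 4$. ${}_{-x}m^{p}_{+y}$ denotes the number of $+y$-segments in the maximal $(-x,+y)$-staircase of the chain containing $p$, i.e. in the longest terminal run of consecutive segments (ending with the last segment) all of which are $-x$-segments or $+y$-segments. It depends only on $\sigma$. *)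

(* Defs.v *)
From HB Require Import structures.
From mathcomp Require Import all_boot all_order all_algebra.
From mathcomp Require Import boolp classical_sets reals.

Set Implicit Arguments.
Unset Strict Implicit.
Unset Printing Implicit Defensive.

Import Order.TTheory GRing.Theory Num.Theory.
Local Open Scope ring_scope.

Inductive turn := Lturn | Rturn.

Definition turn_to_bool (t : turn) : bool := if t is Lturn then true else false.
Definition turn_of_bool (b : bool) : turn := if b then Lturn else Rturn.
Lemma turn_to_boolK : cancel turn_to_bool turn_of_bool.
Proof. by case. Qed.
HB.instance Definition _ := Equality.copy turn (can_type turn_to_boolK).

Notation point := (int * int)%type.

Definition east : point := (1, 0).
Definition north : point := (0, 1).
Definition west : point := (- 1, 0).

Definition rotate (d : point) (t : turn) : point :=
  if t is Lturn then (- d.2, d.1) else (d.2, - d.1).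

(* The unit direction vectors of the n+1 segments of any chain realizing s. *)
Definition directions (s : seq turn) : seq point := east :: scanl rotate east s.

Definition to_plane (R : realType) (a : point) : R * R := (a.1%:~R, a.2%:~R).

Definition on_segment (R : realType) (a b : point) (q : R * R) : Prop :=
  exists2 t : R, 0 <= t <= 1 &
    q = ((1 - t) * (to_plane R a).1 + t * (to_plane R b).1,
         (1 - t) * (to_plane R a).2 + t * (to_plane R b).2).

(* A chain is given by its vertices; segment i joins vertices i and i+1.
   Simplicity is that of the polygonal curve in the real plane: two distinct
   segments meet only if they are consecutive, and then only at their bend. *)
Definition simple_chain (R : realType) (v : seq point) : Prop :=
  forall (i j : nat) (q : R * R), (i < j)%N -> (j.+1 < size v)%N ->
    on_segment (nth 0 v i) (nth 0 v i.+1) q ->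
    on_segment (nth 0 v j) (nth 0 v j.+1) q ->
    j = i.+1 /\ q = to_plane R (nth 0 v j).

Definition realizes (R : realType) (s : seq turn) (v : seq point) : Prop :=
  [/\ size v = (size s).+2,
      nth 0 v 0%N = 0,
      (forall i : nat, (i <= size s)%N ->
         exists2 k : nat, (0 < k)%N &
           nth 0 v i.+1 = nth 0 v i + nth 0 (directions s) i *+ k)
    & simple_chain R v].

Definition reachable (R : realType) (s : seq turn) (p : point) : Prop :=
  exists2 v : seq point, realizes R s v & last 0 v = p.

Definition reachable_negx (R : realType) (s : seq turn) : set int :=
  [set a : int | a < 0 /\ reachable R s (a, 0)]%classic.

(* The abscissa of the reachable point of the negative x-axis closest to the
   origin; the default value 0 is taken only if there is no such point. *)
Definition x_minus (R : realType) (s : seq turn) : int :=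
  xget 0 [set x | reachable_negx R s x /\
                  forall a, reachable_negx R s a -> `|x| <= `|a|]%classic.

Definition staircase_dir (d : point) : bool := (d == west) || (d == north).

(* The number of +y-segments in the maximal (-x,+y)-staircase containing the
   endpoint, read backwards from the last segment. *)
Definition staircase_north (s : seq turn) : nat :=
  let ds := rev (directions s) in
  count_mem north (take (find (predC staircase_dir) ds) ds).

(* Main.v *)
(* A cancelling pair LR or RL can be inserted anywhere into a turn sequence: the
   plane is sheared along a line through one segment, which gets a jog there,
   and everything else keeps its relative position. So drawings of a few short
   words give drawings of all words with the same l - r.
   - Closed polygons for LLL and LLLLL, opened next to a vertex, give distance 1
     for l - r = 3 and 5, and then for l - r = 4.
   - Jogs to the right of the origin do not move the end on the -x-axis, so a
     prefix LL may be replaced by any word with l - r = 2. A prefix LLLL, drawn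
     around the origin, costs one unit of distance. As a sequence with
     l - r >= 4 starts with u LL where u has l - r = 2, (4) follows by induction.
   - For l - r <= 2 a reachable point on the -x-axis forces some prefix with
     |l - r| >= 3: truncate the chain at the first point seen from the origin
     along the axis and apply the Umlaufsatz. Cutting the sequence at such a
     prefix leaves finitely many drawings, all at distance 2, and every further
     final LR costs one unit and one +y-segment of the terminal staircase. *)
Require Import Defs.
From mathcomp Require Import all_boot all_order all_algebra.
From mathcomp Require Import boolp classical_sets reals.
From mathcomp Require Import zify ring lra.

Set Implicit Arguments.
Unset Strict Implicit.
Unset Printing Implicit Defensive.

Section TurnSequences.

Import Order.TTheory GRing.Theory Num.Theory.
Local Open Scope ring_scope.
Local Notation point := (int * int)%type.

(** * Words and headings *)

Inductive dir := East | North | West | South.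

Definition turn_dir (d : dir) (t : turn) : dir :=
  match t, d with
  | Lturn, East => North | Lturn, North => West
  | Lturn, West => South | Lturn, South => East
  | Rturn, East => South | Rturn, South => West
  | Rturn, West => North | Rturn, North => East
  end.

Definition flip (t : turn) : turn := if t is Lturn then Rturn else Lturn.

Definition vertical (d : dir) : bool :=
  match d with North | South => true | _ => false end.

Definition heading (d : dir) (s : seq turn) (k : nat) : dir :=
  foldl turn_dir d (take k s).

Definition level (s : seq turn) : int :=
  (count_mem Lturn s)%:Z - (count_mem Rturn s)%:Z.

Lemma vertical_turn d t : vertical (turn_dir d t) = ~~ vertical d.
Proof. by case: d t => [] []. Qed.

Lemma turn_dirK d t : turn_dir (turn_dir d t) (flip t) = d.
Proof. by case: d t => [] []. Qed.

Lemma flipK : involutive flip.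
Proof. by case. Qed.

Lemma map_flipK : involutive (map flip).
Proof. by move=> s; rewrite -map_comp (eq_map (flipK : flip \o flip =1 id)) map_id. Qed.

Lemma heading0 d s : heading d s 0 = d.
Proof. by rewrite /heading take0. Qed.

Lemma heading_catl d s s' k : (k <= size s)%N ->
  heading d (s ++ s') k = heading d s k.
Proof.
rewrite /heading take_cat leq_eqVlt => /orP[/eqP->|->//].
by rewrite ltnn subnn take0 cats0 take_size.
Qed.

Lemma heading_catr d s s' k :
  heading d (s ++ s') (size s + k) = heading (heading d s (size s)) s' k.
Proof.
by rewrite /heading take_cat ltnNge leq_addr /= addKn foldl_cat take_size.
Qed.

Lemma headingS d s k : (k < size s)%N ->
  heading d s k.+1 = turn_dir (heading d s k) (nth Lturn s k).
Proof.
by move=> ks; rewrite /heading (take_nth Lturn) // foldl_rcons.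
Qed.

Lemma vertical_headingS d s k : (k < size s)%N ->
  vertical (heading d s k.+1) = ~~ vertical (heading d s k).
Proof. by move=> ks; rewrite headingS // vertical_turn. Qed.

Lemma heading_insl d a b t k : (k <= size a)%N ->
  heading d (a ++ t :: flip t :: b) k = heading d (a ++ b) k.
Proof. by move=> ka; rewrite !heading_catl. Qed.

Lemma heading_ins1 d a b t :
  heading d (a ++ t :: flip t :: b) (size a).+1 =
  turn_dir (heading d (a ++ b) (size a)) t.
Proof.
by rewrite -addn1 heading_catr /= heading_catl // /heading /= take0.
Qed.

Lemma heading_insr d a b t k : (size a <= k)%N ->
  heading d (a ++ t :: flip t :: b) k.+2 = heading d (a ++ b) k.
Proof.
move=> ak; rewrite -(subnKC ak) -2!addnS !heading_catr.
by rewrite {1}/heading /= turn_dirK.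
Qed.

Lemma level_cat s s' : level (s ++ s') = level s + level s'.
Proof. rewrite /level !count_cat. lia. Qed.

Lemma level_cons t s : level (t :: s) = (if t is Lturn then 1 else - 1) + level s.
Proof.
rewrite /level; case: t => /=; rewrite ?eqxx.
  by change (Lturn == Rturn) with false; lia.
by change (Rturn == Lturn) with false; lia.
Qed.

Lemma level_nseq n t :
  level (nseq n t) = if t is Lturn then n%:Z else - n%:Z.
Proof.
elim: n => [|n IH]; first by case: t.
by rewrite /= level_cons IH; case: t {IH} => /=; lia.
Qed.

Lemma level_flip s : level (map flip s) = - level s.
Proof. by elim: s => // t s IH; rewrite /= !level_cons IH; case: t => /=; lia. Qed.

Lemma constant_or_cancel s :
  (exists n t, s = nseq n t) \/ exists a b t, s = a ++ t :: flip t :: b.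
Proof.
elim: s => [|t s [[n [u ->]]|[a [b [u ->]]]]]; first by left; exists 0%N, Lturn.
  case: n => [|n]; first by left; exists 1%N, t.
  have [->|] := eqVneq t u; first by left; exists n.+2, u.
  by move=> tu; right; exists [::], (nseq n u), t; case: t u tu => [] [].
by right; exists (t :: a), b, u.
Qed.

(** Deleting adjacent opposite letters keeps the level and ends at a constant word, which is
    determined by its level. So one drawing and stability under insertion settle all words of a
    level. *)
Lemma level_ind (P : seq turn -> Prop) (n : nat) (t0 : turn) :
  P (nseq n t0) ->
  (forall a b t, P (a ++ b) -> P (a ++ t :: flip t :: b)) ->
  forall s, level s = level (nseq n t0) -> P s.
Proof.
move=> P0 PS s; have [m] := ubnP (size s).
elim: m s => // m IH s sm sn.
have [[k [t es]]|[a [b [t es]]]] := constant_or_cancel s; subst s.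
  suff -> : nseq k t = nseq n t0 by [].
  move: sn; rewrite !level_nseq; case: k {sm} => [|k].
    by move=> sn; have -> : n = 0%N by move: sn; case: (t) (t0) => [] []; lia.
  case: (t) (t0) => [] [] sn; try lia; by congr nseq; lia.
apply/PS/IH; first by move: sm; rewrite !size_cat /=; lia.
by rewrite -sn !level_cat !level_cons; case: (t) => /=; lia.
Qed.

(** Levels change by one per letter, so the cut is made before the first letter that lifts the level
    to [n.+1]. *)
Lemma first_passage (n : nat) s i : n.+1%:Z <= level (take i s) ->
  exists a b, [/\ s = a ++ Lturn :: b, level a = n%:Z &
    forall j, level (take j a) <= n%:Z].
Proof.
elim/last_ind: s i => [|s t IH] i; first by rewrite /= /level /=; lia.
have [[j hj]|nj] := pselect (exists j, n.+1%:Z <= level (take j s)).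
  move=> _; have [a [b [-> la ma]]] := IH _ hj.
  by exists a, (rcons b t); split => //; rewrite rcons_cat.
have {}nj j : level (take j s) <= n%:Z.
  by case: (leP (level (take j s)) n%:Z) => // h; case: nj; exists j; lia.
have [si|si] := leqP i (size s).
  by rewrite -cats1 takel_cat // => h; have := nj i; lia.
rewrite take_oversize ?size_rcons // -cats1 level_cat => h.
have := nj (size s); rewrite take_size => h'.
exists s, [::]; case: t h => h; split => //; rewrite /level /= in h h' *; lia.
Qed.

(** * Chains and their symmetries *)

Definition step (d : dir) (a b : point) : bool :=
  match d with
  | East => (a.2 == b.2) && (a.1 < b.1)
  | North => (a.1 == b.1) && (a.2 < b.2)
  | West => (a.2 == b.2) && (b.1 < a.1)
  | South => (a.1 == b.1) && (b.2 < a.2)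
  end.

Definition apart (a b c e : int) : bool :=
  [&& a < c, a < e, b < c & b < e] || [&& c < a, c < b, e < a & e < b].

(* Disjointness of the bounding boxes, which for axis-parallel segments is
   that of the segments. *)
Definition separated (a b c e : point) : bool :=
  apart a.1 b.1 c.1 e.1 || apart a.2 b.2 c.2 e.2.

(* Vertices are indexed by nat and only v 0, ..., v (size s).+1 matter. With
   [cl] the chain is a closed polygon, which also turns at its first vertex. *)
Definition chain (cl : bool) (d : dir) (s : seq turn) (v : nat -> point) : Prop :=
  [/\ forall k, (k <= size s)%N -> step (heading d s k) (v k) (v k.+1),
      forall i j, (i.+1 < j)%N -> (j <= size s)%N ->
        ~~ [&& cl, i == 0%N & j == size s] ->
        separated (v i) (v i.+1) (v j) (v j.+1)
    & cl -> v 0%N = v (size s).+1 /\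
        vertical (heading d s (size s)) = ~~ vertical d].

Lemma apartC a b c e : apart a b c e = apart c e a b.
Proof. rewrite /apart; lia. Qed.

Lemma separatedC a b c e : separated a b c e = separated c e a b.
Proof. by rewrite /separated apartC (apartC a.2). Qed.

Lemma step_vertical d a b : step d a b -> vertical d -> a.1 = b.1.
Proof. by case: d => //= /andP[/eqP]. Qed.

Lemma step_horizontal d a b : step d a b -> ~~ vertical d -> a.2 = b.2.
Proof. by case: d => //= /andP[/eqP]. Qed.

(** The only exempt pair is the first and last segment of a closed polygon, and the closing
    condition makes these perpendicular. *)
Lemma chain_sep cl d s v i j : chain cl d s v ->
  (i.+1 < j)%N || (j.+1 < i)%N -> (i <= size s)%N -> (j <= size s)%N ->
  vertical (heading d s i) = vertical (heading d s j) ->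
  separated (v i) (v i.+1) (v j) (v j.+1).
Proof.
move=> [_ sep per].
wlog ij : i j / (i.+1 < j)%N => [wl ij_ hi hj hv|_ hi hj hv].
  case/orP: ij_ => ij; first by apply: wl; rewrite ?ij.
  by rewrite separatedC; apply: wl; rewrite ?ij.
apply: sep => //; apply/and3P => -[c /eqP i0 /eqP jn].
by move: hv; rewrite i0 jn heading0; have [_ ->] := per c; case: vertical.
Qed.

Lemma separated_map (f : point -> point) :
  (forall a b : point, a.1 < b.1 -> (f a).1 < (f b).1) ->
  (forall a b : point, a.2 < b.2 -> (f a).2 < (f b).2) ->
  forall a b c e, separated a b c e -> separated (f a) (f b) (f c) (f e).
Proof.
move=> f1 f2 a b c e; rewrite /separated /apart.
case/orP=> /orP[] /and4P[h1 h2 h3 h4].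
  + by rewrite (f1 _ _ h1) (f1 _ _ h2) (f1 _ _ h3) (f1 _ _ h4) ?orbT.
  + by rewrite (f1 _ _ h1) (f1 _ _ h2) (f1 _ _ h3) (f1 _ _ h4) ?orbT.
  + by rewrite (f2 _ _ h1) (f2 _ _ h2) (f2 _ _ h3) (f2 _ _ h4) ?orbT.
  + by rewrite (f2 _ _ h1) (f2 _ _ h2) (f2 _ _ h3) (f2 _ _ h4) ?orbT.
Qed.

(** Equal coordinates have to be kept only along segments, because [uncoil] sends points of one row
    to two rows. *)
Lemma chain_map_along (f : point -> point) cl d s v :
  (forall a b : point, a.1 < b.1 -> (f a).1 < (f b).1) ->
  (forall a b : point, a.2 < b.2 -> (f a).2 < (f b).2) ->
  (forall k, (k <= size s)%N -> (v k).1 = (v k.+1).1 -> (f (v k)).1 = (f (v k.+1)).1) ->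
  (forall k, (k <= size s)%N -> (v k).2 = (v k.+1).2 -> (f (v k)).2 = (f (v k.+1)).2) ->
  chain cl d s v -> chain cl d s (f \o v).
Proof.
move=> f1 f2 e1 e2 [st sep per]; split=> [k ks|i j ij js c|c] /=.
- move: (st _ ks); rewrite /step; case: heading => /andP[/eqP h g].
  + by rewrite (e2 _ ks h) eqxx f1.
  + by rewrite (e1 _ ks h) eqxx f2.
  + by rewrite (e2 _ ks h) eqxx f1.
  + by rewrite (e1 _ ks h) eqxx f2.
- exact/(separated_map f1 f2)/sep.
- by have [-> ->] := per c.
Qed.

Lemma chain_map (f : point -> point) cl d s v :
  (forall a b : point, a.1 < b.1 -> (f a).1 < (f b).1) ->
  (forall a b : point, a.2 < b.2 -> (f a).2 < (f b).2) ->
  (forall a b : point, a.1 = b.1 -> (f a).1 = (f b).1) ->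
  (forall a b : point, a.2 = b.2 -> (f a).2 = (f b).2) ->
  chain cl d s v -> chain cl d s (f \o v).
Proof. by move=> f1 f2 e1 e2; apply: chain_map_along => // k _; auto. Qed.

Definition transpose (a : point) : point := (a.2, a.1).
Definition transpose_dir (d : dir) : dir :=
  match d with East => North | North => East | West => South | South => West end.
Definition mirror_x (a : point) : point := (- a.1, a.2).
Definition mirror_x_dir (d : dir) : dir :=
  match d with East => West | West => East | _ => d end.
Definition mirror_y (a : point) : point := (a.1, - a.2).
Definition mirror_y_dir (d : dir) : dir :=
  match d with North => South | South => North | _ => d end.

Lemma heading_reflect (fd : dir -> dir) d s k :
  (forall d t, turn_dir (fd d) (flip t) = fd (turn_dir d t)) ->
  heading (fd d) (map flip s) k = fd (heading d s k).
Proof.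
move=> H; rewrite /heading -map_take.
by elim: (take k s) d => //= t u IH d; rewrite H IH.
Qed.

Lemma chain_reflect (fp : point -> point) (fd : dir -> dir) cl d s v :
  (forall d t, turn_dir (fd d) (flip t) = fd (turn_dir d t)) ->
  (forall d a b, step d a b -> step (fd d) (fp a) (fp b)) ->
  (forall a b c e, separated a b c e ->
     separated (fp a) (fp b) (fp c) (fp e)) ->
  (forall d d', vertical d = ~~ vertical d' ->
     vertical (fd d) = ~~ vertical (fd d')) ->
  chain cl d s v -> chain cl (fd d) (map flip s) (fp \o v).
Proof.
move=> ht hs hd hv [st sep per]; split; rewrite size_map.
- by move=> k ks /=; rewrite heading_reflect //; apply/hs/st.
- by move=> i j ij js c /=; apply/hd/sep.
- move=> c; have [e p] := per c; rewrite /= e; split=> //.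
  by rewrite heading_reflect //; apply: hv.
Qed.

Lemma chain_transpose cl d s v : chain cl d s v ->
  chain cl (transpose_dir d) (map flip s) (transpose \o v).
Proof.
apply: chain_reflect.
- by move=> [] [].
- by move=> [] a b.
- by move=> a b c e; rewrite /separated orbC.
- by move=> [] [].
Qed.

Lemma chain_mirror_x cl d s v : chain cl d s v ->
  chain cl (mirror_x_dir d) (map flip s) (mirror_x \o v).
Proof.
apply: chain_reflect.
- by move=> [] [].
- by move=> [] [a1 a2] [b1 b2] /=; lia.
- by move=> [a1 a2] [b1 b2] [c1 c2] [e1 e2]; rewrite /separated /apart /=; lia.
- by move=> [] [].
Qed.

Lemma chain_mirror_y cl d s v : chain cl d s v ->
  chain cl (mirror_y_dir d) (map flip s) (mirror_y \o v).
Proof.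
apply: chain_reflect.
- by move=> [] [].
- by move=> [] [a1 a2] [b1 b2] /=; lia.
- by move=> [a1 a2] [b1 b2] [c1 c2] [e1 e2]; rewrite /separated /apart /=; lia.
- by move=> [] [].
Qed.

(** * Insertion of a cancelling pair *)

Definition is_right (t : turn) : bool := if t is Rturn then true else false.

(* Preserves strict inequalities between abscissas and all ordinates, hence
   separation; only a vertical segment on the column c through the height h is
   broken, and a unit jog at that height repairs it. *)
Definition shear (c h : int) (up : bool) (a : point) : point :=
  (a.1 + (nat_of_bool ((c < a.1) ||
     ((a.1 == c) && (if up then h < a.2 else a.2 < h))))%:Z, a.2).

Definition insert_vertices (i : nat) (f : point -> point) (q1 q2 : point)
    (v : nat -> point) (k : nat) : point :=
  if (k <= i)%N then f (v k)
  else if k == i.+1 then q1 else if k == i.+2 then q2 else f (v k.-2).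

(** A right turn at height [h] leaves the upper part of the column on the right, whether the segment
    runs up (jog to the east) or down (jog to the west). So the turn alone fixes the shear. *)
Definition insert_vertical (i : nat) (h : int) (t : turn) (v : nat -> point) :=
  let f := shear (v i).1 h (is_right t) in
  insert_vertices i f ((f (v i)).1, h) ((f (v i.+1)).1, h) v.

Definition between (x h y : int) : bool := (x < h) && (h < y) || (y < h) && (h < x).

Lemma insert_verticesP i f q1 q2 v k :
  let w := insert_vertices i f q1 q2 v in
  [\/ (k < i)%N /\ (w k = f (v k) /\ w k.+1 = f (v k.+1)),
      k = i /\ (w k = f (v i) /\ w k.+1 = q1) \/
      k = i.+1 /\ (w k = q1 /\ w k.+1 = q2),
      k = i.+2 /\ (w k = q2 /\ w k.+1 = f (v i.+1)) |
      exists k', [/\ (i < k')%N, k = k'.+2, w k = f (v k') & w k.+1 = f (v k'.+1)]].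
Proof.
rewrite /= /insert_vertices.
have [ki|ik] := ltnP k i; first by apply: Or41; rewrite (ltnW ki).
have [->|k0] := eqVneq k i.
  by apply/Or42/or_introl; rewrite leqnn eqxx.
have -> : (k <= i)%N = false by lia.
have [->|k1] := eqVneq k i.+1.
  by apply/Or42/or_intror; rewrite eqxx; have -> : (i.+2 == i.+1) = false by lia.
have -> : (k.+1 == i.+1) = false by lia.
have -> : (k.+1 == i.+2) = false by lia.
have [->|k2] := eqVneq k i.+2; first by apply: Or43.
by apply: Or44; exists k.-2; split; try lia; congr f; congr v; lia.
Qed.

Section Vertical.

Variables (cl : bool) (d : dir) (a b : seq turn) (t : turn).
Variables (v : nat -> point) (h : int).
Hypothesis hv : chain cl d (a ++ b) v.
Let i := size a.
Let n := size (a ++ b).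
Hypothesis vert : vertical (heading d (a ++ b) i).
Hypothesis hh : between (v i).2 h (v i.+1).2.

Let c := (v i).1.
Let f := shear c h (is_right t).
Let w := insert_vertical i h t v.

Let lei : (i <= n)%N.
Proof. by rewrite /n size_cat leq_addr. Qed.

Let stepi : step (heading d (a ++ b) i) (v i) (v i.+1).
Proof. by have [st _ _] := hv; apply: st. Qed.

Let column : (v i.+1).1 = c.
Proof. by rewrite /c (step_vertical stepi). Qed.

(** What a new segment must satisfy to inherit the separations of the old segment [k]. The pieces of
    the broken segment [i] only need to stay in its box, widened by one column. *)
Let shadow (k : nat) (x y : point) : Prop :=
  (k != i /\ (x = f (v k) /\ y = f (v k.+1))) \/
  (k = i /\ [/\ c <= x.1 <= c + 1, c <= y.1 <= c + 1,
     ((v i).2 <= x.2 <= (v i.+1).2) || ((v i.+1).2 <= x.2 <= (v i).2) &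
     ((v i).2 <= y.2 <= (v i.+1).2) || ((v i.+1).2 <= y.2 <= (v i).2)]).

Let shearP (x : point) : (f x).2 = x.2 /\
  (x.1 < c /\ (f x).1 = x.1 \/ c < x.1 /\ (f x).1 = x.1 + 1 \/
   x.1 = c /\ c <= (f x).1 <= c + 1).
Proof. by rewrite /f /shear /=; split=> //; lia. Qed.

Let shear_lt (x y : point) : x.1 < y.1 -> (f x).1 < (f y).1.
Proof. by move: (shearP x) (shearP y) => [_ hx] [_ hy]; lia. Qed.

Let shadow_point k x y : shadow k x y -> forall z, z = x \/ z = y ->
  [/\ forall u : point, (v k).1 < u.1 -> (v k.+1).1 < u.1 -> z.1 < (f u).1,
      forall u : point, u.1 < (v k).1 -> u.1 < (v k.+1).1 -> (f u).1 < z.1 &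
      ((v k).2 <= z.2 <= (v k.+1).2) || ((v k.+1).2 <= z.2 <= (v k).2)].
Proof.
case=> [[ki [-> ->]]|[-> [hx1 hy1 hx2 hy2]]] z.
  case=> ->; split; try by move=> u *; apply: shear_lt.
    by have [-> _] := shearP (v k); lia.
  by have [-> _] := shearP (v k.+1); lia.
have e := column.
by case=> ->; split=> // u; rewrite e => _ hu; have [_] := shearP u; lia.
Qed.

(** One of the two indices is not [i], so its segment is an image under the monotone shear; for the
    other one the bounds of [shadow_point] suffice. *)
Let shadow_sep k l x y z u : shadow k x y -> shadow l z u -> k != l ->
  separated (v k) (v k.+1) (v l) (v l.+1) -> separated x y z u.
Proof.
wlog li : k l x y z u / l != i => [wl sk sl kl sp|].
  have [li|] := eqVneq l i; last by move=> li; apply: (wl k l).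
  rewrite separatedC; apply: (wl l k) => //; rewrite 1?separatedC //.
    by rewrite -li.
  by rewrite eq_sym.
move=> /shadow_point sk [[_ [-> ->]]|[/eqP]]; last by rewrite (negbTE li).
move=> _; have [[x1 x2 x3] [y1 y2 y3]] := (sk x (or_introl erefl), sk y (or_intror erefl)).
rewrite /separated /apart => /orP[/orP[]/and4P[h1 h2 h3 h4]|].
- by rewrite !x1 ?y1.
- by rewrite !x2 ?y2 // orbT.
have [e1 _] := shearP (v l); have [e2 _] := shearP (v l.+1); rewrite e1 e2.
by case/orP=> /and4P[h1 h2 h3 h4]; apply/orP; right; clear - x3 y3 h1 h2 h3 h4; lia.
Qed.

Let vertical_far k : (k <= n)%N -> k != i -> vertical (heading d (a ++ b) k) ->
  (i.+1 < k)%N || (k.+1 < i)%N.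
Proof.
move=> kn ki hk.
have [e|] := eqVneq k.+1 i; first by move: vert; rewrite -e vertical_headingS ?hk //; lia.
have [e|] := eqVneq k i.+1.
  by move: hk; rewrite e vertical_headingS ?vert //; rewrite /n in kn; lia.
lia.
Qed.

(** The shear tilts only vertical segments that pass the height [h] on the column [c]. Being
    parallel to segment [i], such a segment is not adjacent to it, and it would meet it. *)
Let step_old k : (k <= n)%N -> k != i ->
  step (heading d (a ++ b) k) (f (v k)) (f (v k.+1)).
Proof.
move=> kn ki; have [st _ _] := hv; have := st _ kn.
have [hk|hk] := boolP (vertical (heading d (a ++ b) k)).
  have := chain_sep hv (vertical_far kn ki hk) lei kn; rewrite vert hk => /(_ erefl).
  move=> sp sk; have := step_vertical sk hk; have := step_vertical stepi vert.
  move: hh sp sk; rewrite /between /separated /apart /f /shear -/c.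
  move: hk; case: (heading _ _ k) => //= _; case: is_right; lia.
move: hk (shearP (v k)) (shearP (v k.+1)); case: (heading _ _ k) => //= _; lia.
Qed.

Let row_before k : (k <= n)%N -> k.+1 = i -> (v k).2 = (v i).2 /\ (v k.+1).2 = (v i).2.
Proof.
move=> kn ki; have [st _ _] := hv; have := st _ kn.
move/step_horizontal => -> //; first by rewrite ki.
have kn' : (k < size (a ++ b))%N by have := lei; rewrite -ki.
by move: vert; rewrite -ki vertical_headingS.
Qed.

Let row_after : (i.+1 <= n)%N -> (v i.+2).2 = (v i.+1).2.
Proof.
move=> kn; have [st _ _] := hv; have := st _ kn.
by move/step_horizontal => -> //; rewrite vertical_headingS // vert.
Qed.

Let wP k := insert_verticesP i f ((f (v i)).1, h) ((f (v i.+1)).1, h) v k.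

Let pieces : [/\ w i = f (v i), w i.+1 = ((f (v i)).1, h),
  w i.+2 = ((f (v i.+1)).1, h) & w i.+3 = f (v i.+1)].
Proof.
rewrite /w /insert_vertical /insert_vertices leqnn ltnn !eqxx.
have -> : (i.+1 < i)%N = false by lia.
have -> : (i.+2 < i)%N = false by lia.
have -> : (i.+2 == i.+1) = false by lia.
have -> : (i.+3 == i.+1) = false by lia.
by have -> : (i.+3 == i.+2) = false by lia.
Qed.

Let columns : (f (v i)).1 = c /\ (f (v i.+1)).1 = c + 1 \/
              (f (v i)).1 = c + 1 /\ (f (v i.+1)).1 = c.
Proof. by move: hh column; rewrite /f /shear /between /=; case: is_right; lia. Qed.

Let w_shadow k : (k <= n.+2)%N -> exists o, shadow o (w k) (w k.+1) /\
  [|| (k < i)%N && (o == k), [&& i <= k, k <= i.+2 & o == i]%N |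
     (i < o)%N && (k == o.+2)].
Proof.
have [p0 p1 p2 p3] := pieces; have [_ f0] := shearP (v i).
have [_ f1] := shearP (v i.+1); move: (columns) (column) (hh) => fc col hb.
move: hb; rewrite /between => hb.
move=> kn; case: (wP k) => [[ki [e1 e2]]|[[-> _]|[-> _]]|[-> _]|[k' [ik -> e1 e2]]].
- exists k; split; last lia.
  by left; split; [lia | split].
- exists i; split; last lia.
  by right; split=> //; rewrite p0 p1 /=; split; lia.
- exists i; split; last lia.
  by right; split=> //; rewrite p1 p2 /=; split; lia.
- exists i; split; last lia.
  by right; split=> //; rewrite p2 p3 /=; split; lia.
- exists k'; split; last lia.
  by left; split; [lia | split].
Qed.

Let sep_before (x y : point) : x.2 = (v i).2 -> y.2 = (v i).2 ->
  separated x y (w i.+1) (w i.+2) /\ separated x y (w i.+2) (w i.+3).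
Proof.
move=> hx hy; have [_ -> -> ->] := pieces; have [e _] := shearP (v i.+1).
by move: hh; rewrite /between /separated /apart e hx hy /=; split; lia.
Qed.

Let sep_after (x y : point) : x.2 = (v i.+1).2 -> y.2 = (v i.+1).2 ->
  separated x y (w i) (w i.+1) /\ separated x y (w i.+1) (w i.+2).
Proof.
move=> hx hy; have [-> -> -> _] := pieces; have [e _] := shearP (v i).
by move: hh; rewrite /between /separated /apart e hx hy /=; split; lia.
Qed.

Let sep_jog : separated (w i) (w i.+1) (w i.+2) (w i.+3).
Proof.
by have [-> -> -> ->] := pieces; move: columns; rewrite /separated /apart /=; lia.
Qed.

Let w_old k : (k < i)%N -> w k = f (v k) /\ w k.+1 = f (v k.+1).
Proof. by move=> ki; rewrite /w /insert_vertical /insert_vertices ki (ltnW ki). Qed.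

Let w_new k : (i < k)%N -> w k.+2 = f (v k) /\ w k.+3 = f (v k.+1).
Proof.
move=> ik; rewrite /w /insert_vertical /insert_vertices.
by do 6![rewrite ifF; last lia].
Qed.

Let sep_new k l : (k.+1 < l)%N -> (l <= n.+2)%N ->
  ~~ [&& cl, k == 0%N & l == n.+2] ->
  separated (w k) (w k.+1) (w l) (w l.+1).
Proof.
move=> kl ln ncl; have [_ sep per] := hv.
have [|o [so ho]] := w_shadow (k := k); first lia.
have [|o' [so' ho']] := w_shadow (k := l) => //.
have [oo|oo] := ltnP o.+1 o'.
  have on : (o' <= n)%N by lia.
  (* The first and last segment of a polygon share a vertex and have no separation to pass on. As
     [k], [l] is not the new closing pair, the broken segment is the first or the last old one. *)
  have [/and3P[c0 /eqP eo /eqP eo']|nc] := boolP [&& cl, o == 0%N & o' == n]; last first.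
    by apply: (shadow_sep so so'); [lia | apply: sep].
  have [e0 hn] := per c0; have [st _ _] := hv.
  have [ei|i0] := eqVneq i 0%N.
    have vd : vertical d by move: vert; rewrite ei heading0.
    have [w1 w2] := w_new (k := n) ltac:(lia).
    have rn := step_horizontal (st n (leqnn n)); rewrite hn vd in rn.
    have [||s1 s2] := @sep_before (w l) (w l.+1).
    + have -> : l = n.+2 by lia.
      by rewrite w1; have [-> _] := shearP (v n); rewrite rn // ei e0.
    + have -> : l = n.+2 by lia.
      by rewrite w2; have [-> _] := shearP (v n.+1); rewrite ei e0.
    rewrite separatedC; have : (k == i.+1) || (k == i.+2).
      by clear - ho ei ncl kl oo c0 eo eo' ho' ln; lia.
    by case/orP=> /eqP ->.
  have ein : i = n by lia.
  have vd : vertical d = false by move: vert; rewrite ein hn; case: vertical.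
  have [w1 w2] := w_old (k := 0%N) ltac:(lia).
  have := step_horizontal (st 0%N (leq0n n)); rewrite heading0 vd => /(_ isT) r0.
  have -> : k = 0%N by lia.
  have [||s1 s2] := @sep_after (w 0%N) (w 1%N).
  + by rewrite w1; have [-> _] := shearP (v 0%N); rewrite ein e0.
  + by rewrite w2; have [-> _] := shearP (v 1%N); rewrite -r0 ein e0.
  have : (l == i) || (l == i.+1).
    by clear - ho' ln ein eo' oo ncl c0 i0 lei ho eo kl; lia.
  by case/orP=> /eqP ->.
(* The remaining pairs come from one old segment or from two consecutive ones, so at least one
   member is a piece of segment [i]. *)
have : [|| (k == i) && (l == i.+2), (k.+1 == i) && ((l == i.+1) || (l == i.+2)) |
         (l == i.+3) && ((k == i) || (k == i.+1))] by clear - ho ho' kl oo; lia.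
case/or3P=> /andP[/eqP ki].
- by rewrite ki => /eqP ->.
- have [w1 w2] := w_old (k := k) ltac:(lia).
  have [r1 r2] := row_before (k := k) ltac:(lia) ki.
  have [||s1 s2] := @sep_before (w k) (w k.+1).
  + by rewrite w1; have [-> _] := shearP (v k).
  + by rewrite w2; have [-> _] := shearP (v k.+1).
  by case/orP=> /eqP ->.
have [w1 w2] := w_new (k := i.+1) (ltnSn _).
have [||s1 s2] := @sep_after (w l) (w l.+1).
- by rewrite ki w1; have [-> _] := shearP (v i.+1).
- by rewrite ki w2; have [-> _] := shearP (v i.+2); apply: row_after; lia.
by case/orP=> /eqP ->; rewrite separatedC.
Qed.

Lemma chain_insert_vertical : chain cl d (a ++ t :: flip t :: b) w.
Proof.
have sz : size (a ++ t :: flip t :: b) = n.+2 by rewrite /n !size_cat /= !addnS.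
have [p0 p1 p2 p3] := pieces; have [st sep per] := hv.
split; rewrite ?sz.
- move=> k kn.
  case: (wP k) => [[ki [e1 e2]]|[[-> _]|[-> _]]|[-> _]|[k' [ik ek e1 e2]]].
  + rewrite heading_insl; last exact: ltnW.
    by rewrite (e1 : w k = _) (e2 : w k.+1 = _); apply: step_old; lia.
  + rewrite heading_insl // p0 p1; move: (stepi) vert hh.
    by rewrite /between -/i; case: (heading _ _ _) => //=; lia.
  + rewrite heading_ins1 p1 p2 -/i; move: (stepi) vert hh.
    rewrite /between /f /shear.
    by case: (heading _ _ _) (t) => [] [] //=; have := column; rewrite /c; lia.
  + rewrite heading_insr // p2 p3; move: (stepi) vert hh.
    by rewrite /between -/i; case: (heading _ _ _) => //=; lia.
  + rewrite ek heading_insr; last exact: ltnW.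
    rewrite ek in e1 e2; rewrite (e1 : w k'.+2 = _) (e2 : w k'.+3 = _).
    by apply: step_old; lia.
- by move=> k l kl ln ncl; apply: sep_new.
- move=> c0; have [e1 e2] := per c0.
  have -> : w 0%N = f (v 0%N) by [].
  have -> : w n.+3 = f (v n.+1).
    rewrite /w /insert_vertical /insert_vertices.
    by do 3![rewrite ifN; last lia].
  by rewrite e1 heading_insr.
Qed.

End Vertical.

(** * Insertion into horizontal segments and into closed polygons *)

Lemma insert_vertices_le i f q1 q2 v k : (k <= i)%N ->
  insert_vertices i f q1 q2 v k = f (v k).
Proof. by rewrite /insert_vertices => ->. Qed.

Lemma insert_vertices1 i f q1 q2 v : insert_vertices i f q1 q2 v i.+1 = q1.
Proof. by rewrite /insert_vertices ltnn eqxx. Qed.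

Lemma insert_vertices2 i f q1 q2 v : insert_vertices i f q1 q2 v i.+2 = q2.
Proof. by rewrite /insert_vertices eqxx !ifN //; lia. Qed.

Lemma insert_vertices_gt i f q1 q2 v k : (i < k)%N ->
  insert_vertices i f q1 q2 v k.+2 = f (v k).
Proof. by move=> ik; rewrite /insert_vertices !ifN //; lia. Qed.

Lemma shear_left c h up (x : point) : x.1 < c -> shear c h up x = x.
Proof. by case: x => x y /= xc; rewrite /shear /=; congr pair; lia. Qed.

Lemma shear_ge c h up (x : point) : x.1 <= (shear c h up x).1.
Proof. by rewrite /shear /=; lia. Qed.

(** Transposition exchanges left and right, hence the [flip t]. *)
Definition insert_horizontal (i : nat) (h : int) (t : turn) (v : nat -> point) :=
  transpose \o insert_vertical i h (flip t) (transpose \o v).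

Lemma chain_insert_horizontal cl d a b t v h :
  chain cl d (a ++ b) v -> ~~ vertical (heading d (a ++ b) (size a)) ->
  between (v (size a)).1 h (v (size a).+1).1 ->
  chain cl d (a ++ t :: flip t :: b) (insert_horizontal (size a) h t v).
Proof.
move=> hv hh hb.
have := chain_transpose hv; rewrite map_cat => hv'.
have := @chain_insert_vertical cl (transpose_dir d) (map flip a) (map flip b)
  (flip t) _ h hv'; rewrite size_map -map_cat heading_reflect; last by move=> [] [].
have hx : vertical (transpose_dir (heading d (a ++ b) (size a))).
  by move: hh; case: heading.
move/(_ hx hb)/chain_transpose.
rewrite -/(insert_horizontal _ _ _ _) map_cat /= !flipK !map_flipK.
by have -> : transpose_dir (transpose_dir d) = d by case: (d).
Qed.

Lemma closed_insert d a b t :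
  (exists v, chain true d (a ++ b) v) ->
  exists v, chain true d (a ++ t :: flip t :: b) v.
Proof.
(* After doubling, the sum of the old end coordinates of a segment lies strictly inside it. *)
case=> v0 hv0; pose f (x : point) := (x.1 *+ 2, x.2 *+ 2).
have hv : chain true d (a ++ b) (f \o v0).
  by apply: chain_map hv0 => x y; rewrite /f /=; lia.
have [st _ _] := hv0; have := st (size a); rewrite size_cat leq_addr => /(_ isT) sta.
set i := size a in sta *.
have [hvert|hvert] := boolP (vertical (heading d (a ++ b) i)).
  exists (insert_vertical i ((v0 i).2 + (v0 i.+1).2) t (f \o v0)).
  apply: chain_insert_vertical => //; rewrite /between /f /= -/i.
  by move: sta hvert; case: heading => //=; lia.
exists (insert_horizontal i ((v0 i).1 + (v0 i.+1).1) t (f \o v0)).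
apply: chain_insert_horizontal => //; rewrite /between /f /= -/i.
by move: sta hvert; case: heading => //=; lia.
Qed.

(* As the bends of [w] lie to the right of both endpoints, shears that insert
   turns into [w] do not change the distance of the endpoints. *)
Definition right_bends (d : dir) (u w z : seq turn) (x0 x1 : int)
    (v : nat -> point) : Prop :=
  [/\ chain false d (u ++ w ++ z) v, (v 0%N).1 = x0,
      (v (size (u ++ w ++ z)).+1).1 = x1,
      (v 0%N).2 = (v (size (u ++ w ++ z)).+1).2 &
      forall k, (size u < k)%N -> (k <= size u + size w)%N -> 0 < (v k).1].

(** Doubling abscissas only in the right half plane makes room for jogs there and keeps the
    abscissas of endpoints with [x0 <= 0] and [x1 <= 0]. *)
Definition stretch (x : point) : point :=
  (if x.1 <= 0 then x.1 else x.1 *+ 2, x.2 *+ 2).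

Lemma stretchP (x : point) : (stretch x).2 = x.2 *+ 2 /\
  (x.1 <= 0 /\ (stretch x).1 = x.1 \/ 0 < x.1 /\ (stretch x).1 = x.1 *+ 2).
Proof. by split=> //; rewrite /stretch /=; case: ifP; lia. Qed.

(** The segment receiving the pair has a bend of [w1 ++ w2] as an end, so it reaches into the right
    half plane. If it is vertical, its column is right of both endpoints and the shear fixes them.
    If it is horizontal, the jog is put at a positive abscissa [h]; the endpoints share a row and
    lie left of [h], so they rise by the same amount. *)
Lemma right_bends_insert d u w1 w2 z t x0 x1 : x0 <= 0 -> x1 <= 0 ->
  (0 < size (w1 ++ w2))%N ->
  (exists v, right_bends d u (w1 ++ w2) z x0 x1 v) ->
  exists v, right_bends d u (w1 ++ t :: flip t :: w2) z x0 x1 v.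
Proof.
move=> hx0 hx1 hw [v0 [hv0 e0 e1 e2 bends]].
have [f fE] : exists f : point -> point, f = stretch by exists stretch.
have f01 (x : point) : x.1 <= 0 /\ (f x).1 = x.1 \/ 0 < x.1 /\ (f x).1 = x.1 *+ 2.
  by rewrite fE; have [] := stretchP x.
have f2 (x : point) : (f x).2 = x.2 *+ 2 by rewrite fE; have [] := stretchP x.
have es : u ++ (w1 ++ w2) ++ z = (u ++ w1) ++ (w2 ++ z) by rewrite !catA.
have es' : u ++ (w1 ++ t :: flip t :: w2) ++ z =
           (u ++ w1) ++ t :: flip t :: (w2 ++ z) by rewrite -!catA.
have sz : size (u ++ (w1 ++ t :: flip t :: w2) ++ z) =
          (size (u ++ (w1 ++ w2) ++ z)).+2.
  by rewrite !size_cat /=; lia.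
set n := size (u ++ (w1 ++ w2) ++ z) in sz e1 e2.
have in_ : (size (u ++ w1) <= n)%N by rewrite /n es [size (_ ++ (_ ++ _))]size_cat leq_addr.
have [st _ _] := hv0; have := st _ in_; rewrite es => sti.
have hv : chain false d ((u ++ w1) ++ (w2 ++ z)) (f \o v0).
  rewrite -es; apply: chain_map hv0 => x y xy.
  - by have := f01 y; have := f01 x; lia.
  - by rewrite !f2; lia.
  - by rewrite fE /stretch xy.
  - by rewrite !f2 xy.
have hvert := @chain_insert_vertical _ _ _ _ t _
  ((v0 (size (u ++ w1))).2 + (v0 (size (u ++ w1)).+1).2) hv.
(* For a horizontal segment the right end is positive and even after stretching, and the left end is
   at least two units away or not positive. So [h] is positive and strictly inside. *)
pose h := Num.max (f (v0 (size (u ++ w1)))).1 (f (v0 (size (u ++ w1)).+1)).1 - 1.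
have hhor := @chain_insert_horizontal _ _ _ _ t _ h hv.
rewrite {}/h in hhor.
have [i ei] : exists i, i = size (u ++ w1) by exists (size (u ++ w1)).
rewrite -ei in in_ sti hvert hhor.
have iE : i = (size u + size w1)%N by rewrite ei size_cat.
rewrite size_cat in hw bends.
have bend : 0 < (v0 i).1 \/ 0 < (v0 i.+1).1.
  by have [w0|w0] := posnP (size w1); [right|left]; apply: bends; lia.
have bends' k : (size u < k)%N -> (k <= size u + (size w1 + size w2))%N ->
   2 <= (f (v0 k)).1.
  by move=> h1 h2; have := bends k h1 h2 => h3; have := f01 (v0 k); lia.
clear ei; case: (boolP (vertical _)) hvert hhor => [vi hvert _|vi _ hhor].
  have {hvert} := hvert isT.
  have -> : between ((f \o v0) i).2 ((v0 i).2 + (v0 i.+1).2) ((f \o v0) i.+1).2.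
    rewrite /between /= !f2; move: sti vi; case: heading => //=; lia.
  move/(_ isT); set v := insert_vertical _ _ _ _ => hc.
  have ec := step_vertical sti vi.
  have col : 0 < (f (v0 i)).1 by have := f01 (v0 i); case: bend; lia.
  exists v; split; rewrite ?sz ?es' //.
  - by rewrite /v /insert_vertical insert_vertices_le // shear_left /=;
    have := f01 (v0 0%N); lia.
  - by rewrite /v /insert_vertical insert_vertices_gt ?ltnS // shear_left /=;
    have := f01 (v0 n.+1); lia.
  - by rewrite /v /insert_vertical insert_vertices_gt ?ltnS // insert_vertices_le //= !f2 e2.
  - rewrite size_cat /= !addnS => k hk1 hk2; rewrite /v /insert_vertical.
    have [ki|ik] := leqP k i.
      rewrite insert_vertices_le //; apply: lt_le_trans (shear_ge _ _ _ _) => /=.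
      by have := bends' k hk1; lia.
    have [->|k1] := eqVneq k i.+1.
      by rewrite insert_vertices1 /=; apply: lt_le_trans (shear_ge _ _ _ _) => /=.
    have [->|k2] := eqVneq k i.+2.
      rewrite insert_vertices2; apply: lt_le_trans (shear_ge _ _ _ _) => /=.
      by have := f01 (v0 i.+1); have := f01 (v0 i); lia.
    have ek : k = k.-2.+2 by lia.
    rewrite ek insert_vertices_gt; last lia.
    apply: lt_le_trans (shear_ge _ _ _ _) => /=.
    by have := bends' k.-2; lia.
move: hhor; set h := _ - 1 => hhor.
have hP : 0 < h /\ between (f (v0 i)).1 h (f (v0 i.+1)).1.
  have := f01 (v0 i.+1); have := f01 (v0 i).
  by move: sti vi bend; rewrite /between /h; case: heading => //=; lia.
have [h0 hb] := hP; have := hhor isT hb; set v := insert_horizontal _ _ _ _ => hc.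
exists v; split; rewrite ?sz ?es' //.
- rewrite /v /insert_horizontal /insert_vertical /=.
  by have := f01 (v0 0%N); lia.
- rewrite /v /insert_horizontal /insert_vertical /=.
  by rewrite insert_vertices_gt ?ltnS //=; have := f01 (v0 n.+1); lia.
- rewrite /v /insert_horizontal /insert_vertical /=.
  rewrite insert_vertices_gt ?ltnS //= !f2 e2.
  have := f01 (v0 0%N); have := f01 (v0 n.+1).
  by case: is_right; lia.
- rewrite size_cat /= !addnS => k hk1 hk2.
  rewrite /v /insert_horizontal /insert_vertical /=.
  have [ki|ik] := leqP k i.
    by rewrite insert_vertices_le //=; have := bends' k hk1; lia.
  have [->|k1] := eqVneq k i.+1; first by rewrite insert_vertices1.
  have [->|k2] := eqVneq k i.+2; first by rewrite insert_vertices2.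
  have ek : k = k.-2.+2 by lia.
  rewrite ek insert_vertices_gt /=; last lia.
  by have := bends' k.-2; lia.
Qed.

(** * Reachable distances *)

(** The first vertex is left free, which spares translations; [reaches_reachable] moves it to the
    origin. *)
Definition reaches_by (s : seq turn) (k : nat) (v : nat -> point) : Prop :=
  [/\ chain false East s v, (v 0%N).2 = (v (size s).+1).2 &
      (v 0%N).1 = (v (size s).+1).1 + k%:Z].

Definition reaches (s : seq turn) (k : nat) : Prop := exists v, reaches_by s k v.

Lemma separated_left (a b c e : point) : separated a b c e -> separated a b c c.
Proof. by rewrite /separated /apart; lia. Qed.

Lemma separated_right (a b c e : point) : separated a b c e -> separated a b e e.
Proof. by rewrite /separated /apart; lia. Qed.

Definition shift (c e : int) (a : point) : point := (a.1 + c, a.2 + e).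

Lemma chain_shift c e cl d s v : chain cl d s v -> chain cl d s (shift c e \o v).
Proof. by apply: chain_map => a b; rewrite /shift /=; lia. Qed.

Lemma reaches_flip s k : reaches (map flip s) k -> reaches s k.
Proof.
case=> v [hv e1 e2]; exists (mirror_y \o v); split.
- by have := chain_mirror_y hv; rewrite map_flipK.
- by move: e1; rewrite size_map /= => ->.
- by move: e2; rewrite size_map.
Qed.

(** The first two bends of a chain with prefix LL lie right of its start, and all words of level 2
    arise from LL by insertions. The level is carried through the induction to keep the word
    nonempty. *)
Lemma replace_front a s k : level a = 2 ->
  reaches (Lturn :: Lturn :: s) k -> reaches (a ++ s) k.
Proof.
move=> la [v [hv e1 e2]].
suff [_ [w [hw f0 f1 f2 _]]] : level a = 2 /\
    exists w, right_bends East [::] a s 0 (- k%:Z) w.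
  by exists w; split=> //; rewrite f0 f1; lia.
have {la} : level a = level (nseq 2 Lturn) by rewrite la.
move: a; apply: level_ind; last first.
  move=> b c t [lbc hbc]; split.
    by move: lbc; rewrite !level_cat !level_cons; case: (t) => /=; lia.
  apply: right_bends_insert => //; first lia.
  by case: (b ++ c) lbc.
split=> //; exists (shift (- (v 0%N).1) 0 \o v); split.
- exact: chain_shift.
- by rewrite /=; lia.
- by move: e2; rewrite /=; lia.
- by rewrite /= e1.
- have [st _ _] := hv; have := st 0%N isT; have := st 1%N isT.
  by move=> /= h1 h0 [|[|[|i]]] //= _ _; move: h0 h1; rewrite /heading /=; lia.
Qed.

(** A reflection in the vertical line through the endpoint moves the bends of RR to its right and
    turns the level -2 into 2. *)
Lemma replace_back u g z k v : level g = - 2 ->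
  reaches_by (u ++ [:: Rturn; Rturn] ++ z) k v ->
  (forall i, (size u < i)%N -> (i <= (size u).+2)%N ->
     (v i).1 < (v (size u + size z).+3).1) ->
  reaches (u ++ g ++ z) k.
Proof.
move=> lg [hv e1 e2] left.
have sz : size (u ++ [:: Rturn; Rturn] ++ z) = (size u + size z).+2.
  by rewrite !size_cat /=; lia.
rewrite sz in e1 e2.
pose c := (v (size u + size z).+3).1.
suff [_ [w [hw f0 f1 f2 _]]] : level (map flip g) = 2 /\
    exists w, right_bends West (map flip u) (map flip g) (map flip z) (- k%:Z) 0 w.
  exists (mirror_x \o w); split.
  - by move: (chain_mirror_x hw); rewrite -!map_cat map_flipK.
  - by move: f2; rewrite -!map_cat !size_map /=.
  - by move: f0 f1; rewrite -!map_cat !size_map /= => -> ->; lia.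
have : level (map flip g) = level (nseq 2 Lturn) by rewrite level_flip lg.
move: (map flip g); apply: level_ind; last first.
  move=> b b' t [lbc hbc]; split.
    by move: lbc; rewrite !level_cat !level_cons; case: (t) => /=; lia.
  apply: right_bends_insert => //; first lia.
  by case: (b ++ b') lbc.
split=> //; exists (shift c 0 \o (mirror_x \o v)).
have sz' : size (map flip u ++ nseq 2 Lturn ++ map flip z) = (size u + size z).+2.
  by rewrite !size_cat !size_map /=; lia.
split; rewrite ?sz'.
- apply: chain_shift; have := chain_mirror_x hv; by rewrite !map_cat.
- by move: e2; rewrite /= -/c; lia.
- by rewrite /= -/c; lia.
- by rewrite /= e1.
- rewrite size_map /= => i h1 h2; have := left i h1; rewrite -/c; lia.
Qed.

(** The next to last segment meets the last one only at their bend, strictly behind the endpoint;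
    earlier segments are separated from the whole last segment. *)
Lemma chain_sep_end d s v i : chain false d s v -> (i < size s)%N ->
  separated (v i) (v i.+1) (v (size s).+1) (v (size s).+1).
Proof.
move=> [st sep _] hi; have [|e] := ltnP i.+1 (size s).
  by move=> h; apply: separated_right (sep _ _ h (leqnn _) isT).
have := vertical_headingS d hi; have -> : i.+1 = size s by lia.
have := st i (ltnW hi); have := st _ (leqnn (size s)).
have -> : size s = i.+1 by lia.
rewrite /step /separated /apart.
by case: (heading d s i) => //=; case: (heading d s i.+1) => //=; lia.
Qed.

Lemma chain_rcons d s v t q : chain false d s v ->
  step (turn_dir (heading d s (size s)) t) (v (size s).+1) q ->
  (forall i, (i < size s)%N -> separated (v i) (v i.+1) (v (size s).+1) q) ->
  chain false d (rcons s t) (fun k => if (k <= (size s).+1)%N then v k else q).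
Proof.
move=> [st sep _] stq sepq; split=> //; rewrite size_rcons.
  move=> k kn; have [->|kn'] := eqVneq k (size s).+1.
    rewrite leqnn ltnn -cats1 -[(size s).+1]addn1 heading_catr addn1.
    by rewrite {1}/heading.
  rewrite -cats1 heading_catl; last lia.
  by rewrite !ifT; [apply: st| |]; lia.
move=> i j ij jn _; have [ej|jn'] := eqVneq j (size s).+1.
  by rewrite ej leqnn ltnn !ifT; [apply: sepq| |]; lia.
by rewrite !ifT; [apply: sep| | | |]; lia.
Qed.

(** Moving everything strictly left of the endpoint one unit west frees a column for the end of the
    added segment; the start does not move. *)
Lemma reaches_west s k t : turn_dir (heading East s (size s)) t = West ->
  reaches s k -> reaches (rcons s t) k.+1.
Proof.
move=> hw [v [hv e1 e2]]; set p := v (size s).+1 in e1 e2.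
have [f fE] : exists f : point -> point, f = fun a : point =>
    (a.1 - (nat_of_bool (a.1 < p.1))%:Z, a.2) by eexists.
have hf : chain false East s (f \o v).
  apply: chain_map hv => a b; rewrite fE /=; lia.
have fp : f p = p by rewrite fE; case: (p) => x y; congr pair => /=; lia.
have := @chain_rcons _ _ _ t (p.1 - 1, p.2) hf.
rewrite hw /= -/p fp eqxx => hc.
exists (fun k => if (k <= (size s).+1)%N then (f \o v) k else (p.1 - 1, p.2)).
split; last 2 first.
- by rewrite size_rcons ltnn /= fE e1.
- by rewrite size_rcons ltnn /= fE; have := e2; rewrite /=; lia.
apply: hc => [|i hi]; first by rewrite ltrBlDr ltrDl.
have := chain_sep_end hv hi; rewrite -/p fE /separated /apart /=; lia.
Qed.

(** The end moves one unit west with everything in or left of its column, and the added segment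
    returns it to its old place in the freed column. *)
Lemma reaches_east s k t : turn_dir (heading East s (size s)) t = East ->
  (0 < k)%N -> reaches s k -> reaches (rcons s t) k.
Proof.
move=> hw k0 [v [hv e1 e2]]; set p := v (size s).+1 in e1 e2.
have [f fE] : exists f : point -> point, f = fun a : point =>
    (a.1 - (nat_of_bool (a.1 <= p.1))%:Z, a.2) by eexists.
have hf : chain false East s (f \o v).
  apply: chain_map hv => a b; rewrite fE /=; lia.
have fp : f p = (p.1 - 1, p.2) by rewrite fE; congr pair => /=; lia.
have := @chain_rcons _ _ _ t p hf.
rewrite hw /= -/p fp eqxx => hc.
exists (fun k => if (k <= (size s).+1)%N then (f \o v) k else p).
split; last 2 first.
- by rewrite size_rcons ltnn /= fE e1.
- by rewrite size_rcons ltnn /= fE; have := e2; rewrite /=; lia.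
apply: hc => [|i hi]; first by rewrite /=; lia.
have := chain_sep_end hv hi; rewrite -/p fE /separated /apart /=; lia.
Qed.

(** The pair is inserted into the last segment just below the endpoint; the shear moves the start,
    which lies further right, but not the endpoint. *)
Lemma reaches_jog s k : heading East s (size s) = North -> (0 < k)%N ->
  reaches s k -> reaches (s ++ [:: Lturn; Rturn]) k.+1.
Proof.
move=> hn k0 [v0 [hv0 e1 e2]].
have [f fE] : exists f : point -> point, f = fun a : point => (a.1, a.2 *+ 2) by eexists.
have f1 (x : point) : (f x).1 = x.1 by rewrite fE.
have f2 (x : point) : (f x).2 = x.2 *+ 2 by rewrite fE.
have hv : chain false East (s ++ [::]) (f \o v0).
  by rewrite cats0; apply: chain_map hv0 => a b; rewrite ?f1 ?f2 //; lia.
have [st _ _] := hv0; have := st _ (leqnn _); rewrite hn /= => /andP[/eqP c1 c2].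
have := @chain_insert_vertical _ _ _ _ Lturn _ ((f (v0 (size s).+1)).2 - 1) hv.
rewrite cats0 hn => /(_ isT).
have -> : between ((f \o v0) (size s)).2 ((f (v0 (size s).+1)).2 - 1)
                  ((f \o v0) (size s).+1).2.
  by rewrite /between /= !f2; lia.
move/(_ isT) => hc; eexists; split; first exact: hc.
- rewrite size_cat /= addn2 /insert_vertical insert_vertices_gt //.
  by rewrite /= !f2 e1.
- rewrite size_cat /= addn2 /insert_vertical insert_vertices_gt //.
  by rewrite /= !f2 !f1; lia.
Qed.

(** Columns 0 and 1 and row 1 are emptied for the turn around the new origin. Row 0 is split at the
    old first vertex: the left part, with the endpoint, stays; the right part sinks to row -1. *)
Definition uncoil (a : point) : point :=
  (if a.1 <= 0 then a.1 - 1 else a.1 + 1,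
   if 0 < a.2 then a.2 + 1 else if a.2 < 0 then a.2 - 1
   else if a.1 < 0 then 0 else - 1).

Lemma uncoilP (a : point) :
  (a.1 <= 0 /\ (uncoil a).1 = a.1 - 1 \/ 0 < a.1 /\ (uncoil a).1 = a.1 + 1) /\
  (0 < a.2 /\ (uncoil a).2 = a.2 + 1 \/ a.2 < 0 /\ (uncoil a).2 = a.2 - 1 \/
   a.2 = 0 /\ (a.1 < 0 /\ (uncoil a).2 = 0 \/ 0 <= a.1 /\ (uncoil a).2 = - 1)).
Proof. by rewrite /uncoil /=; do 4?[case: ifP]; lia. Qed.

Definition coil_vertices (f : point -> point) (v : nat -> point) (k : nat) : point :=
  match k with
  | 0 => (0, 0) | 1 => (1, 0) | 2 => (1, 1) | 3 => (- 1, 1)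
  | k'.+4 => f (v k')
  end.

(* The first vertex is blown up to a turn around the new origin, which is
   separated from the old end by one more vertical segment. *)
Lemma reaches_coil s k : (0 < k)%N -> reaches s k ->
  reaches [:: Lturn, Lturn, Lturn, Lturn & s] k.+1.
Proof.
move: uncoilP; move: uncoil => U UP.
move=> k0 [v0 [hv0 e1 e2]].
pose v := shift (- (v0 0%N).1) (- (v0 0%N).2) \o v0.
have hv : chain false East s v by apply: chain_shift.
have o1 : (v 0%N).1 = 0 by rewrite /v /=; lia.
have o2 : (v 0%N).2 = 0 by rewrite /v /=; lia.
have p1 : (v (size s).+1).1 = - k%:Z by rewrite /v /=; lia.
have p2 : (v (size s).+1).2 = 0 by rewrite /v /=; lia.
clearbody v; clear hv0 e1 e2 v0; have [st sep _] := hv.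
have st0 := st 0%N isT; rewrite heading0 /= in st0.
(* Later segments avoid the first vertex, so no horizontal one joins the two parts of row 0. *)
have away i : (0 < i)%N -> (i <= size s)%N -> separated (v i) (v i.+1) (v 0%N) (v 0%N).
  move=> i0 hi; have [i1|i1] := ltnP 1 i.
    have := sep _ _ i1 hi isT; rewrite separatedC.
    by move/separated_left.
  have -> : i = 1%N by lia.
  have := st 1%N; have -> : (1 <= size s)%N by lia.
  move=> /(_ isT)/step_vertical; rewrite headingS; last lia.
  rewrite vertical_turn heading0 => /(_ isT).
  by move: st0; rewrite /separated /apart; lia.
have hu : chain false East s (U \o v).
  apply: chain_map_along hv => [a b|a b|i hi|i hi].
  - by move: (UP a) (UP b) => [h1 _] [h2 _]; lia.
  - by move: (UP a) (UP b) => [_ h1] [_ h2]; lia.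
  - by move: (UP (v i)) (UP (v i.+1)) => [h1 _] [h2 _]; lia.
  - move: (UP (v i)) (UP (v i.+1)) => [_ h1] [_ h2].
    have [i0|i0] := posnP i; first by subst i; lia.
    by have := away i i0 hi; rewrite /separated /apart o1 o2; lia.
have [stu sepu _] := hu.
exists (coil_vertices U v); split; last 2 first.
- change (0 = (U (v (size s).+1)).2).
  by have [_ h] := UP (v (size s).+1); lia.
- change (0 = (U (v (size s).+1)).1 + k.+1%:Z).
  by have [h _] := UP (v (size s).+1); lia.
have u0 : U (v 0%N) = (- 1, - 1).
  rewrite (surjective_pairing (U _)); have [h1 h2] := UP (v 0%N).
  by congr pair; lia.
split=> //.
- move=> [|[|[|[|i]]]] hi //.
  + by rewrite /heading /= u0.
  + by have := stu i hi.
- move=> i [|[|[|[|j]]]] // ij jn _.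
    by case: i ij => [|i].
    by rewrite [coil_vertices U v 4]u0; case: i ij => [|[|i]].
  have [i4|i4] := ltnP i 4; last first.
    have {i4} [i' ei] : exists i', i = i'.+4 by exists (i - 4)%N; lia.
    by rewrite ei; apply: (sepu i' j) => //; lia.
  have [j0|j0] := posnP j.
    have := st0; rewrite j0 /= u0; have [h1 h2] := UP (v 1%N).
    by case: i ij i4 => [|[|[|[|i]]]] //=; rewrite ?j0 // /separated /apart /=; lia.
  have := away j j0 jn; rewrite /= /separated /apart o1 o2.
  have [h1 h2] := UP (v j); have [h3 h4] := UP (v j.+1).
  by case: i ij i4 => [|[|[|[|i]]]] //= _ _; rewrite ?u0 /=; lia.
Qed.

(** The start slides one unit along the first segment, away from the closing vertex. The last
    segment is vertical, so it misses the shortened first one, and doubling the abscissas keeps the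
    latter from vanishing. *)
Lemma closed_reaches s : (0 < size s)%N -> (exists v, chain true East s v) -> reaches s 1.
Proof.
move=> s0 [v0 hv0].
have [f fE] : exists f : point -> point, f = fun a : point => (a.1 *+ 2, a.2) by eexists.
have f1 (x : point) : (f x).1 = x.1 *+ 2 by rewrite fE.
have f2 (x : point) : (f x).2 = x.2 by rewrite fE.
have hv : chain true East s (f \o v0).
  by apply: chain_map hv0 => a b; rewrite ?f1 ?f2 //; lia.
have [st0 _ _] := hv0; have := st0 0%N isT; rewrite heading0 /= => /andP[/eqP y0 x0].
have [st sep per] := hv; have [ec vn] := per isT.
pose v k := if k == 0%N then ((f (v0 0%N)).1 + 1, (f (v0 0%N)).2) else f (v0 k).
exists v; split.
- split=> //.
  + move=> [|k] hk; last exact: (st k.+1 hk).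
    by rewrite heading0 /v /= !f1 !f2; lia.
  + move=> [|i] [|j] // ij jn _; last exact: (sep i.+1 j.+1 ij jn isT).
    have [jn'|jn'] := eqVneq j.+1 (size s); last first.
      have := sep 0%N j.+1 ij jn; rewrite (negbTE jn') => /(_ isT).
      by rewrite /v /= /separated /apart /= !f1 !f2; lia.
    have := step_vertical (st _ (leqnn (size s))); rewrite vn => /(_ isT).
    rewrite -ec -jn' /v /separated /apart /= !f1 !f2 => e.
    have := congr1 fst ec; rewrite /= -jn' !f1; lia.
- by rewrite /v /=; rewrite /= in ec; rewrite -ec.
- by rewrite /v /=; rewrite /= in ec; rewrite -ec.
Qed.

(** * Closed polygons and the levels from 3 on *)

Definition chainb (cl : bool) (s : seq turn) (l : seq point) : bool :=
  let v := nth (0, 0) l in let n := size s in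
  [&& all (fun k => step (heading East s k) (v k) (v k.+1)) (iota 0 n.+1),
      all (fun i => all (fun j => ~~ ((i.+1 < j)%N && ~~ [&& cl, i == 0%N & j == n]) ||
         separated (v i) (v i.+1) (v j) (v j.+1)) (iota 0 n.+1)) (iota 0 n.+1) &
      cl ==> (v 0%N == v n.+1) && vertical (heading East s n)].

Lemma chainbP cl s l : chainb cl s l -> chain cl East s (nth (0, 0) l).
Proof.
case/and3P=> /allP st /allP sep per; split.
- by move=> k ks; apply: st; rewrite mem_iota add0n ltnS.
- move=> i j ij js c; have := sep i; rewrite mem_iota add0n ltnS.
  move=> /(_ (leq_trans (ltnW (ltnW ij)) js))/allP/(_ j).
  by rewrite mem_iota add0n ltnS ij c => /(_ js).
- by move=> c; move: per; rewrite c => /andP[/eqP -> ->].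
Qed.

Lemma closed_level3 s : level s = 3 -> exists v, chain true East s v.
Proof.
have -> : 3 = level (nseq 3 Lturn) by [].
move: s; apply: level_ind; last by move=> a b t; apply: closed_insert.
(* The unit square; its fourth left turn is at the first vertex. *)
by exists (nth (0, 0) [:: (0, 0); (1, 0); (1, 1); (0, 1); (0, 0)]); apply: chainbP; vm_compute.
Qed.

Lemma closed_level5 s : level s = 5 -> exists v, chain true East s v.
Proof.
have -> : 5 = level (nseq 5 Lturn) by [].
move: s; apply: level_ind; last by move=> a b t; apply: closed_insert.
(* An L-shaped hexagon with its reflex corner at the first vertex: five left turns and this right
   turn add up to 4. *)
exists (nth (0, 0) [:: (0, 0); (1, 0); (1, 1); (- 1, 1); (- 1, - 1); (0, - 1); (0, 0)]).
by apply: chainbP; vm_compute.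
Qed.

Definition quadrant (d : dir) : int :=
  match d with East => 0 | North => 1 | West => 2 | South => 3 end.

Lemma level_heading s :
  exists z : int, level s = z *+ 4 + quadrant (heading East s (size s)).
Proof.
elim/last_ind: s => [|s t [z IH]]; first by exists 0.
have -> : heading East (rcons s t) (size (rcons s t)) =
          turn_dir (heading East s (size s)) t.
  by rewrite /heading !take_size foldl_rcons.
rewrite -cats1 level_cat IH; case: t; case: heading => /=;
  [exists z|exists z|exists z|exists (z + 1)|exists (z - 1)|exists z|exists z|exists z];
  rewrite /level /=; lia.
Qed.

Lemma level_rcons s t : level (rcons s t) = level s + if t is Lturn then 1 else - 1.
Proof. by rewrite -cats1 level_cat level_cons [level [::]]/= addr0. Qed.

Lemma heading_of_level s (d : dir) (z : int) :
  level s = z *+ 4 + quadrant d -> heading East s (size s) = d.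
Proof.
have [z' ->] := level_heading s.
by case: heading; case: d => //= e; exfalso; lia.
Qed.

Lemma reaches_level3 s : level s = 3 -> reaches s 1.
Proof. by move=> e; apply: closed_reaches; [case: s e | apply: closed_level3]. Qed.

Lemma reaches_level5 s : level s = 5 -> reaches s 1.
Proof. by move=> e; apply: closed_reaches; [case: s e | apply: closed_level5]. Qed.

(** Without its last letter the word has level 3 or 5, and the last segment heads east, which costs
    no distance. *)
Lemma reaches_level4 s : level s = 4 -> reaches s 1.
Proof.
case/lastP: s => // s t; rewrite level_rcons; case: t => e.
  apply: reaches_east => //; last by apply: reaches_level3; lia.
  by rewrite (@heading_of_level s South 0) //=; lia.
apply: reaches_east => //; last by apply: reaches_level5; lia.
by rewrite (@heading_of_level s North 1) //=; lia.
Qed.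

Lemma reaches_one s : 3 <= `|level s| <= 5 -> reaches s 1.
Proof.
wlog h : s / 3 <= level s => [wl|].
  have [|] := leP 3 (level s); first exact: wl.
  by move=> *; apply: reaches_flip; apply: wl; rewrite level_flip; lia.
have [e _|n3] := eqVneq (level s) 3; first exact: reaches_level3.
have [e _|n4] := eqVneq (level s) 4; first exact: reaches_level4.
by move=> *; apply: reaches_level5; lia.
Qed.

Lemma split3 s i : 3 <= level (take i s) ->
  exists a b, s = a ++ Lturn :: b /\ level a = 2.
Proof. by move/(@first_passage 2) => [a [b [es la _]]]; exists a, b. Qed.

(** Just before level 4 is first reached the level is 3, and it cannot have come down from 4; so it
    rose from 2 by an L. *)
Lemma split4 s i : 4 <= level (take i s) ->
  exists a b, s = a ++ [:: Lturn, Lturn & b] /\ level a = 2.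
Proof.
move/(@first_passage 3) => [a [b [es la ma]]].
case/lastP: a => // a t in es la ma *; rewrite level_rcons in la.
have := ma (size a); rewrite -cats1 take_size_cat // => h.
case: t es la {ma} => es la; last lia.
by exists a, b; rewrite es cat_rcons; split=> //; lia.
Qed.

Lemma reaches_two a g : level a = 2 -> 3 <= `|level g| <= 5 ->
  reaches (a ++ [:: Lturn, Lturn & g]) 2.
Proof. by move=> la lg; apply: replace_front => //; apply/reaches_coil/reaches_one. Qed.

(** Each removed LLLL lowers the level by 4 and the distance by one, down to the levels 3 to 5. The
    residue 2 would skip these and arrive at level 2. *)
Lemma reaches_around s m : level s = m%:Z -> (3 <= m)%N -> (m %% 4 != 2)%N ->
  reaches s ((m + 2) %/ 4).
Proof.
have [j] := ubnP m; elim: j m s => // j IH m s mj e m3 mm.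
have [m5|m5] := leqP m 5.
  have -> : ((m + 2) %/ 4 = 1)%N by lia.
  by apply: reaches_one; lia.
have [|a [b [es la]]] := @split4 s (size s); first by rewrite take_size; lia.
move: e; rewrite es level_cat !level_cons la => e.
have -> : ((m + 2) %/ 4 = (m - 4 + 2) %/ 4 + 1)%N by lia.
by rewrite addn1; apply: replace_front => //; apply: reaches_coil; [|apply: IH]; lia.
Qed.

(** The last segment heads west and adds one unit to a drawing of the word without its last letter,
    of level [m - 1] or [m + 1]; the distances of these two levels differ by one. *)
Lemma reaches_around2 s t m : level (rcons s t) = m%:Z -> (3 <= m)%N ->
  (m %% 4 = 2)%N ->
  reaches (rcons s t) ((m + 2) %/ 4 + if t is Rturn then 1 else 0)%N.
Proof.
rewrite level_rcons; case: t => e m3 mm.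
  have -> : ((m + 2) %/ 4 + 0 = ((m - 1 + 2) %/ 4).+1)%N by lia.
  apply: reaches_west; last by apply: reaches_around; lia.
  rewrite (@heading_of_level s North (m %/ 4)%N%:Z) //=; lia.
have -> : ((m + 2) %/ 4 + 1 = ((m + 1 + 2) %/ 4).+1)%N by lia.
apply: reaches_west; last by apply: reaches_around; lia.
rewrite (@heading_of_level s South (m %/ 4)%N%:Z) //=; lia.
Qed.

(** The drawing has RR in place of [g], with both bends in column -3, left of the endpoint, as
    [replace_back] requires. The next two drawings share this. *)
Lemma draw_LLLRg g : level g = - 2 -> reaches [:: Lturn, Lturn, Lturn, Rturn & g] 2.
Proof.
move=> lg; rewrite -[g]cats0.
apply: (@replace_back [:: Lturn; Lturn; Lturn; Rturn] g [::] 2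
  (nth (0, 0) [:: (0, 0); (1, 0); (1, 1); (- 1, 1); (- 1, - 1); (- 3, - 1);
                  (- 3, 0); (- 2, 0)])) => //.
  by split=> //; apply: chainbP; vm_compute.
by do 7?[case=> //].
Qed.

Lemma draw_LLLRgL g : level g = - 2 ->
  reaches [:: Lturn, Lturn, Lturn, Rturn & rcons g Lturn] 2.
Proof.
move=> lg; rewrite -cats1.
apply: (@replace_back [:: Lturn; Lturn; Lturn; Rturn] g [:: Lturn] 2
  (nth (0, 0) [:: (0, 0); (1, 0); (1, 1); (- 1, 1); (- 1, - 2); (- 3, - 2);
                  (- 3, - 1); (- 2, - 1); (- 2, 0)])) => //.
  by split=> //; apply: chainbP; vm_compute.
by do 7?[case=> //].
Qed.

Lemma draw_LLLRgR g : level g = - 2 ->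
  reaches [:: Lturn, Lturn, Lturn, Rturn & rcons g Rturn] 2.
Proof.
move=> lg; rewrite -cats1.
apply: (@replace_back [:: Lturn; Lturn; Lturn; Rturn] g [:: Rturn] 2
  (nth (0, 0) [:: (0, 0); (1, 0); (1, 1); (- 1, 1); (- 1, - 1); (- 3, - 1);
                  (- 3, 1); (- 2, 1); (- 2, 0)])) => //.
  by split=> //; apply: chainbP; vm_compute.
by do 7?[case=> //].
Qed.

Lemma draw_LLLRR : reaches [:: Lturn; Lturn; Lturn; Rturn; Rturn] 2.
Proof.
exists (nth (0, 0) [:: (0, 0); (1, 0); (1, 1); (- 1, 1); (- 1, - 1); (- 2, - 1); (- 2, 0)]).
by split=> //; apply: chainbP; vm_compute.
Qed.

(** * Words of level 0 with a prefix of level at least 3 in absolute value *)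

Definition wide (s : seq turn) : Prop := exists i, 3 <= `|level (take i s)|.

Lemma wide_rcons s t : wide (rcons s t) -> `|level (rcons s t)| < 3 -> wide s.
Proof.
case=> i hi hs; have [si|si] := leqP i (size s).
  by exists i; rewrite -cats1 takel_cat in hi.
by rewrite take_oversize ?size_rcons // in hi; lia.
Qed.

(** The letter after the passage to level 3 decides: L leaves a rest of level -4 behind a coil, R a
    rest of level -2 for the explicit drawing. *)
Lemma reaches_level0 s : level s = 0 -> wide s -> reaches s 2.
Proof.
move=> ls [i]; wlog hi : s ls / 3 <= level (take i s) => [wl h|_].
  have [|hl] := leP 3 (level (take i s)); first by move/wl; apply.
  apply: reaches_flip; apply: wl; rewrite ?level_flip -?map_take ?level_flip ?normrN //; lia.
have [a [b [es la]]] := split3 hi; subst s.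
move: ls; rewrite level_cat level_cons la; case: b {hi} => [|t g] //.
rewrite level_cons; case: t => lg; first by apply: reaches_two => //; lia.
by apply: replace_front => //; apply: draw_LLLRg; lia.
Qed.

(** * Staircases and small levels *)

Definition unit_vector (d : dir) : point :=
  match d with
  | East => (1, 0) | North => (0, 1) | West => (- 1, 0) | South => (0, - 1)
  end.

Lemma rotate_unit_vector d t : rotate (unit_vector d) t = unit_vector (turn_dir d t).
Proof. by case: d t => [] []. Qed.

Lemma directions_rcons s t : directions (rcons s t) =
  rcons (directions s) (unit_vector (heading East (rcons s t) (size (rcons s t)))).
Proof.
rewrite /directions scanl_rcons rcons_cons /heading take_size !foldl_rcons.
congr (_ :: rcons _ _).
have H d : foldl rotate (unit_vector d) s = unit_vector (foldl turn_dir d s).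
  by elim: s d => //= u s IH d; rewrite rotate_unit_vector IH.
by rewrite (H East) rotate_unit_vector.
Qed.

Lemma size_directions s : size (directions s) = (size s).+1.
Proof. by rewrite /directions /= size_scanl. Qed.

Lemma nth_directions s i : (i <= size s)%N ->
  nth 0 (directions s) i = unit_vector (heading East s i).
Proof.
elim/last_ind: s => [|s t IH]; first by case: i.
rewrite directions_rcons nth_rcons size_directions size_rcons ltnS => hi.
have [is_|is_] := leqP i (size s).
  by rewrite IH // -cats1 heading_catl.
have -> : i = (size s).+1 by lia.
by rewrite eqxx.
Qed.

Lemma staircase_north_rcons s t :
  let d := heading East (rcons s t) (size (rcons s t)) in
  staircase_north (rcons s t) =
  match d with
  | North => (staircase_north s).+1 | West => staircase_north s | _ => 0%N
  end.
Proof.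
move=> d; rewrite /staircase_north directions_rcons -/d rev_rcons.
by case: d.
Qed.

Lemma staircase_north_gt0 s : heading East s (size s) = North ->
  (0 < staircase_north s)%N.
Proof. by case/lastP: s => // s t hn; rewrite staircase_north_rcons hn. Qed.

(** At level 1 the last segment heads north, so distance 2 always meets the bound. It is attained
    unless the word ends in LR and no prefix has level 4; then LR is removed and put back by
    [reaches_jog]. *)
Lemma reaches_level1 s : level s = 1 -> wide s ->
  exists k, [/\ (0 < k)%N, (k <= staircase_north s + 1)%N & reaches s k].
Proof.
have [n] := ubnP (size s); elim: n s => // n IH s sn ls ws.
have hn : heading East s (size s) = North by apply: (@heading_of_level s North 0).
suff : reaches s 2 \/
    exists k, [/\ (0 < k)%N, (k <= staircase_north s + 1)%N & reaches s k].
  by case=> // h; exists 2%N; have := staircase_north_gt0 hn; split=> //; lia.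
have [[i /split4[a [b [es la]]]]|no4] := pselect (exists i, 4 <= level (take i s)).
  left; rewrite es; apply: reaches_two => //.
  by move: ls; rewrite es level_cat !level_cons la; lia.
move: sn ls ws hn no4; case/lastP: s => // s t sn ls ws hn no4.
have ws' : wide s by apply: wide_rcons ws _; rewrite ls.
have := ls; rewrite level_rcons.
case: t sn ls ws hn no4 => sn ls ws hn no4 ls'.
  (* The word ends in L, and without it the level is 0: the cut of [reaches_level0] is repeated with
     the extra final letter, which becomes R under reflection. *)
  left; case: ws' => i.
  have [hi _|hl hi] := leP 3 (level (take i s)).
    have [a [b [es la]]] := split3 hi.
    move: ls'; rewrite es level_cat level_cons la {es}.
    case: b => [|u g]; first by rewrite /level /=; lia.
    rewrite level_cons => lg; rewrite rcons_cat !rcons_cons; case: u lg => lg.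
      by apply: reaches_two => //; rewrite level_rcons; lia.
    by apply: replace_front => //; apply: draw_LLLRgL; lia.
  apply: reaches_flip.
  have {hl} hi' : 3 <= level (take i (map flip s)).
    by rewrite -map_take level_flip; lia.
  have [a [b [es la]]] := split3 hi'.
  have : level (map flip s) = 0 by rewrite level_flip; lia.
  rewrite map_rcons es level_cat level_cons la.
  case: b {es} => [|u g]; first by rewrite /level /=; lia.
  rewrite level_cons => lg; rewrite rcons_cat !rcons_cons; case: u lg => lg.
    by apply: reaches_two => //; rewrite level_rcons /=; lia.
  by apply: replace_front => //; apply: draw_LLLRgR; lia.
move: ls' sn ls ws hn no4 ws'; case/lastP: s => [|s u] ls'.
  by move: ls'; rewrite /level /=; lia.
move: ls'; rewrite level_rcons; case: u => ls' sn ls ws hn no4 ws'.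
  right; have lS : level s = 1 by lia.
  have hs : heading East s (size s) = North by apply: (@heading_of_level s North 0).
  have [|||k [k0 kk hk]] := IH s.
  - by move: sn; rewrite !size_rcons; lia.
  - by [].
  - by apply: wide_rcons ws' _; rewrite level_rcons; lia.
  exists k.+1; split=> //.
    have hw : heading East (rcons s Lturn) (size (rcons s Lturn)) = West.
      by apply: (@heading_of_level _ West 0); rewrite level_rcons lS.
    by rewrite staircase_north_rcons hn staircase_north_rcons hw; lia.
  by have := reaches_jog hs k0 hk; rewrite -!cats1 -catA.
(* The word ends in RR; the letter before is L, since R would leave a prefix of level 4. *)
left; clear sn ls ws hn ws'; move: no4 ls'; case/lastP: s => [|s u] no4.
  by rewrite /level /=; lia.
rewrite level_rcons; case: u no4 => no4 ls'.
  rewrite -!cats1 -!catA /=; apply: replace_front; first lia.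
  exact: draw_LLLRR.
case: no4; exists (size s); rewrite -!cats1 -!catA take_size_cat //; lia.
Qed.

Lemma reaches_level2 s : level (rcons s Lturn) = 2 -> wide s ->
  exists k, [/\ (0 < k)%N, (k <= staircase_north (rcons s Lturn) + 2)%N &
    reaches (rcons s Lturn) k].
Proof.
rewrite level_rcons /= => ls ws.
have hs : heading East s (size s) = North by apply: (@heading_of_level s North 0) => /=; lia.
have [|k [k0 kk hk]] := reaches_level1 _ ws; first lia.
exists k.+1; split=> //; last by apply: reaches_west hk; rewrite hs.
have hw : heading East (rcons s Lturn) (size (rcons s Lturn)) = West.
  by apply: (@heading_of_level _ West 0); rewrite level_rcons /=; lia.
by rewrite staircase_north_rcons hw; lia.
Qed.

Lemma reaches_level2R s : level (rcons s Rturn) = 2 -> reaches (rcons s Rturn) 2.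
Proof.
rewrite level_rcons /= => ls; apply: reaches_west; last by apply: reaches_one; lia.
by rewrite (@heading_of_level s South 0) //=; lia.
Qed.

(** * A rectilinear Umlaufsatz *)

(* Crossing of the ray that leaves the origin through (1/2, 1/2) and then
   runs to the right between the rows 0 and 1. *)
Definition crosses (a b : point) : bool :=
  [&& a.1 == b.1, 0 < a.1 &
      (a.2 == 0) && (b.2 == 1) || (a.2 == 1) && (b.2 == 0)].

Lemma crosses_step (a : point) (e : dir) : crosses a (a + unit_vector e) =
  match e with
  | North => (0 < a.1) && (a.2 == 0)
  | South => (0 < a.1) && (a.2 == 1)
  | _ => false
  end.
Proof. by case: a => x y; rewrite /crosses; case: e => /=; lia. Qed.

Definition opposite (d : dir) : dir :=
  match d with East => West | North => South | West => East | South => North end.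

Lemma opp_unit_vector d : - unit_vector d = unit_vector (opposite d).
Proof. by case: d. Qed.

Lemma point_neq0 (a : point) : (a != 0) = ~~ ((a.1 == 0) && (a.2 == 0)).
Proof. by case: a. Qed.

(** Two paths around a unit cell whose corners avoid the origin cross the ray equally often modulo
    2. *)
Lemma crosses_cell (a : point) (c e : dir) :
  a != 0 -> a + unit_vector c != 0 -> a + unit_vector e != 0 ->
  a + unit_vector c + unit_vector e != 0 ->
  crosses a (a + unit_vector e) (+)
  crosses (a + unit_vector e) (a + unit_vector c + unit_vector e) =
  crosses a (a + unit_vector c) (+)
  crosses (a + unit_vector c) (a + unit_vector c + unit_vector e).
Proof.
rewrite {2}[a + _ + unit_vector e]addrAC !crosses_step !point_neq0; case: a => x y.
by case: c; case: e => //=; lia.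
Qed.

Lemma abs_le2 (m : int) :
  `|m| <= 2 -> [|| m == - 2, m == - 1, m == 0, m == 1 | m == 2].
Proof. lia. Qed.

(** Meant for levels between -2 and 2, which act as lifts of the heading: both -2 and 2 head
    west. *)
Definition level_dir (l : int) : dir :=
  if l == 0 then East else if l == 1 then North else if l == - 1 then South else West.

(** The ray starts between east and north, so it separates the lifts up to 0 from those from 1
    on. *)
Lemma crosses_corner (l l' : int) : `|l| <= 2 -> `|l'| <= 2 -> `|l' - l| <= 1 ->
  let a := unit_vector (level_dir l) in let b := unit_vector (level_dir l') in
  crosses a (a + b) (+) crosses (a + b) b = (1 <= l) (+) (1 <= l').
Proof.
by move=> /abs_le2 /or4P[|||/orP[]] /eqP-> /abs_le2 /or4P[|||/orP[]] /eqP->.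
Qed.

(* Hopf's proof of the Umlaufsatz, modulo 2: [phi i j] is the parity of the
   winding of the direction p j - p i, continued from the i-th step. It changes
   by [crosses] along the edges of the triangle i < j, and there is no
   monodromy since p j - p i never vanishes. *)
Lemma parity_obstruction (n : nat) (p : nat -> point) (l : nat -> int) (q : int) :
  p 0%N = 0 -> p n = (q, 0) -> q < 0 ->
  (forall i, (i < n)%N -> p i.+1 = p i + unit_vector (level_dir (l i))) ->
  (forall i, (i < n)%N -> `|l i| <= 2) ->
  (forall i, (i.+1 < n)%N -> `|l i.+1 - l i| <= 1) -> l 0%N = 0 ->
  (forall i j, (i < j)%N -> (j <= n)%N -> p i <> p j) ->
  (forall i, (0 < i)%N -> (i < n)%N -> ~~ [&& (p i).2 == 0, q <= (p i).1 & (p i).1 <= 0]) ->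
  False.
Proof.
move=> p0 pn q0 st l2 l1 l0 inj free.
have n1 : (1 < n)%N.
  case: n pn st {l2 l1 inj free} => [|[|n]] // pn st; first by move: pn; rewrite p0 => -[]; lia.
  by move: pn; rewrite (st 0%N) // p0 l0 => -[]; lia.
pose f i j := p j - p i.
have f0 i j : (i < j)%N -> (j <= n)%N -> f i j != 0.
  by move=> ij jn; rewrite subr_eq0; apply/eqP => e; apply: (inj _ _ ij jn); rewrite e.
have fr i j : (j < n)%N -> f i j.+1 = f i j + unit_vector (level_dir (l j)).
  by move=> jn; rewrite /f st // addrAC.
have fl i j : (i < n)%N -> f i.+1 j = f i j - unit_vector (level_dir (l i)).
  by move=> jn; rewrite /f st // opprD addrA.
pose phi i j := (1 <= l i) (+)
  \big[addb/false]_(i.+1 <= k < j) crosses (f i k) (f i k.+1).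
have phi1 i : phi i i.+1 = (1 <= l i) by rewrite /phi big_geq // addbF.
have phiS i j : (i < j)%N -> phi i j.+1 = phi i j (+) crosses (f i j) (f i j.+1).
  by move=> ij; rewrite /phi big_nat_recr //= addbA.
(* The absence of monodromy: [phi] may also be continued in its first index. [crosses_corner] starts
   the induction and each further [j] adds one cell. *)
have ladder i j : (i.+1 < j)%N -> (j <= n)%N ->
    phi i j (+) phi i.+1 j = crosses (f i j) (f i.+1 j).
  elim: j => // j IH; rewrite ltnS leq_eqVlt => /orP[/eqP <- jn|ij jn].
    rewrite phiS // !phi1.
    have fi : f i i.+1 = unit_vector (level_dir (l i)).
      by rewrite fr ?/f ?subrr ?add0r //; lia.
    have fi1 : f i.+1 i.+2 = unit_vector (level_dir (l i.+1)).
      by rewrite fr ?/f ?subrr ?add0r //; lia.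
    rewrite fi fr // fi fi1.
    have := @crosses_corner (l i) (l i.+1) (l2 _ _) (l2 _ _) (l1 _ jn).
    move=> /(_ ltac:(lia) ltac:(lia)) /=.
    by case: crosses; case: crosses; case: (_ <= l i); case: (_ <= l i.+1).
  have := IH ij (ltnW jn); rewrite !phiS //; last exact: ltnW.
  have in_ : (i < n)%N by lia.
  have := @crosses_cell (f i j) (opposite (level_dir (l i))) (level_dir (l j)).
  rewrite -opp_unit_vector -(fl _ _ in_) -(fr i _ jn) -(fr i.+1 _ jn).
  have -> : f i j != 0 by apply: f0; lia.
  have -> : f i.+1 j != 0 by apply: f0; lia.
  have -> : f i j.+1 != 0 by apply: f0; lia.
  have -> : f i.+1 j.+1 != 0 by apply: f0; lia.
  move=> /(_ isT isT isT isT).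
  move: (crosses _ _) (crosses _ _) (crosses _ _) (crosses _ _) (phi _ _) (phi _ _).
  by do 6![case].
(* The walk passes the axis only right of the origin, where the direction from [p 0] crosses the
   ray, or left of [p n], where the direction to [p n] does. Axis points on the left count as above,
   to match the rows in [crosses]. *)
pose up (a : point) := (0 < a.2) || (a.2 == 0) && (a.1 < 0).
have edge k : (0 < k)%N -> (k.+1 < n)%N ->
    crosses (f 0%N k) (f 0%N k.+1) (+) crosses (f k n) (f k.+1 n) =
    up (p k) (+) up (p k.+1).
  move=> k0 kn; have := free k k0 (ltnW kn); have := free k.+1 isT kn.
  rewrite /f p0 !subr0 pn st; last lia.
  rewrite /crosses /up; case: (p k) => x y.
  by case: level_dir => /=; lia.
have first : phi 0%N n = phi 1%N n.
  have := ladder 0%N n n1 (leqnn n).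
  have -> : crosses (f 0%N n) (f 1%N n) = false.
    by rewrite /crosses /f pn p0 subr0 /=; lia.
  by case: (phi 0%N n); case: (phi 1%N n).
have walk j : (0 < j)%N -> (j < n)%N ->
    phi 0%N j = phi 1%N n (+) phi j n (+) up (p 1%N) (+) up (p j).
  elim: j => // -[|j] IH _ jn.
    by rewrite phi1 l0; case: (phi 1%N n); case: (up _).
  rewrite phiS // (IH isT (ltnW jn)).
  have := edge j.+1 isT jn; rewrite -(ladder j.+1 n jn (leqnn n)).
  move: (crosses _ _) (phi 1%N n) (phi j.+1 n) (phi j.+2 n) (up _) (up _) (up _).
  by do 7![case].
have nS : n = n.-1.+1 by lia.
have last : phi 0%N n = phi 0%N n.-1.
  rewrite {1}nS phiS; last lia.
  have -> : crosses (f 0%N n.-1) (f 0%N n.-1.+1) = false.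
    by rewrite -nS /crosses /f pn p0 subr0 /=; lia.
  by rewrite addbF.
have hn : (n.-1 < n)%N by lia.
have end_ : phi n.-1 n = (1 <= l n.-1) by rewrite {2}nS phi1.
(* This leaves [up (p n.-1) = (1 <= l n.-1)], which fails for a last step to the east, north or
   south; a step to the west contradicts [free]. *)
have := walk n.-1 ltac:(lia) hn; rewrite -last first end_.
have -> : up (p 1%N) = false by rewrite st ?p0 ?l0 //; lia.
have := free n.-1 ltac:(lia) hn; have := l2 _ hn; have := st _ hn; rewrite -nS pn.
clear - q0; rewrite /up; move: (l n.-1) (phi 1%N n) => m; case: (p n.-1) => x y.
move=> b e /abs_le2 /or4P[|||/orP[]] /eqP em; move: e; rewrite em => -[e1 e2] /=;
  case: b; lia.
Qed.

(** * Chains in the real plane *)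

Section RealPlane.

Variable R : realType.

Lemma convex_lt (a b c e : int) (t u : R) : 0 <= t <= 1 -> 0 <= u <= 1 ->
  a < c -> a < e -> b < c -> b < e ->
  (1 - t) * a%:~R + t * b%:~R < (1 - u) * c%:~R + u * e%:~R.
Proof.
move=> /andP[t0 t1] /andP[u0 u1] h1 h2 h3 h4.
pose m : int := Num.max a b.
have [ma mb] : a <= m /\ b <= m by rewrite /m; lia.
have [mc me] : m + 1 <= c /\ m + 1 <= e by rewrite /m; lia.
move: ma mb mc me; rewrite -!(ler_int R) !rmorphD /= => ma mb mc me.
clear h1 h2 h3 h4; nra.
Qed.

Lemma apart_convex (a b c e : int) (t u : R) : 0 <= t <= 1 -> 0 <= u <= 1 ->
  apart a b c e ->
  (1 - t) * a%:~R + t * b%:~R <> (1 - u) * c%:~R + u * e%:~R.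
Proof.
move=> ht hu /orP[] /and4P[h1 h2 h3 h4] eq.
  by have := convex_lt ht hu h1 h2 h3 h4; rewrite eq ltxx.
by have := convex_lt hu ht h1 h2 h3 h4; rewrite eq ltxx.
Qed.

Lemma separated_segments (a b c e : point) (q : R * R) : separated a b c e ->
  on_segment a b q -> on_segment c e q -> False.
Proof.
move=> sep [t ht ->] [u hu [/esym e1 /esym e2]].
by case/orP: sep => sep; [apply: (apart_convex ht hu sep) | apply: (apart_convex ht hu sep)].
Qed.

Lemma on_segment_row (a b : point) (q : R * R) : a.2 = b.2 ->
  on_segment a b q -> q.2 = (a.2)%:~R.
Proof. by move=> ab [t _ ->] /=; rewrite ab; lra. Qed.

Lemma on_segment_column (a b : point) (q : R * R) : a.1 = b.1 ->
  on_segment a b q -> q.1 = (a.1)%:~R.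
Proof. by move=> ab [t _ ->] /=; rewrite ab; lra. Qed.

(** Consecutive segments are perpendicular, so each fixes one coordinate of a common point, which
    must be the bend. *)
Lemma chain_simple s v : chain false East s v ->
  simple_chain R (mkseq v (size s).+2).
Proof.
move=> hv i j q ij; rewrite size_mkseq !ltnS => js.
have [st sep _] := hv; rewrite !nth_mkseq; try lia.
have [ij1|ij1] := ltnP i.+1 j.
  by move=> qi qj; have [] := separated_segments (sep i j ij1 js isT) qi qj.
have ej : j = i.+1 by lia.
subst j; move=> qi qj; split=> //.
have si := st i (ltnW js); have sj := st _ js.
have := vertical_headingS East js.
rewrite (surjective_pairing q) /to_plane; case: (boolP (vertical (heading East s i))) => hi hj.
  rewrite (on_segment_column (step_vertical si hi) qi) (step_vertical si hi).
  by rewrite (on_segment_row (step_horizontal sj (negbT hj)) qj).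
rewrite (on_segment_row (step_horizontal si hi) qi) (step_horizontal si hi).
by rewrite (on_segment_column (step_vertical sj hj) qj).
Qed.

Lemma point_muln (x : point) k : x *+ k = (x.1 *+ k, x.2 *+ k).
Proof. by elim: k => // k IH; rewrite !mulrS IH. Qed.

Lemma step_multiple d (a b : point) : step d a b ->
  exists2 k : nat, (0 < k)%N & b = a + unit_vector d *+ k.
Proof.
case: a b => [a1 a2] [b1 b2]; case: d => /andP[/eqP /= e1 /= e2];
  [exists `|b1 - a1|%N|exists `|b2 - a2|%N|exists `|b1 - a1|%N|exists `|b2 - a2|%N];
  try lia; rewrite point_muln; congr pair; rewrite /=; lia.
Qed.

Lemma reaches_reachable s k : reaches s k -> reachable R s (- k%:Z, 0).
Proof.
case=> v0 [hv0 e1 e2].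
have hv := chain_shift (- (v0 0%N).1) (- (v0 0%N).2) hv0.
set v := _ \o v0 in hv; exists (mkseq v (size s).+2); last first.
  rewrite (last_nth 0) size_mkseq /= -/(mkseq _ _).
  rewrite -[nth _ _ _]/(nth 0 (mkseq v (size s).+2) (size s).+1) nth_mkseq //.
  by rewrite /v /shift /=; congr pair; lia.
have [st _ _] := hv; split.
- by rewrite size_mkseq.
- by rewrite nth_mkseq // /v /shift /=; congr pair; lia.
- move=> i si; rewrite !nth_mkseq //; try lia.
  by rewrite nth_directions //; apply: step_multiple; apply: st.
- exact: chain_simple.
Qed.

Lemma reaches_x_minus s k : (0 < k)%N -> reaches s k -> (`|x_minus R s| <= k)%N.
Proof.
move=> k0 /reaches_reachable hk.
(* Distances are natural numbers, so a closest point exists and [xget] does not return its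
   default. *)
have [n0 [[a0 [ha0 en0]] hmin]] : exists n, (exists a, reachable_negx R s a /\ `|a|%N = n) /\
    forall a, reachable_negx R s a -> (n <= `|a|)%N.
  have ex : exists n, `[< exists a, reachable_negx R s a /\ `|a|%N = n >].
    exists k; apply/asboolP; exists (- k%:Z); split; last by lia.
    by split; [lia | exact: hk].
  case: (ex_minnP ex) => n /asboolP hn hmin; exists n; split=> // a ha.
  by apply: hmin; apply/asboolP; exists a.
rewrite /x_minus; case: xgetP => [x _ [_ hx]|none].
  have := hx (- k%:Z); rewrite /reachable_negx /= => h.
  have : `|x| <= `|- k%:Z| by apply: h; split; [lia | exact: hk].
  by lia.
by exfalso; apply: (none a0); split=> // a ha; have := hmin a ha; lia.
Qed.

Lemma to_plane_inj : injective (@to_plane R).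
Proof. by move=> [a1 a2] [b1 b2] [/intr_inj -> /intr_inj ->]. Qed.

Lemma unit_vectorM_inj d : injective (fun t => unit_vector d *+ t).
Proof. by move=> t t'; rewrite !point_muln; case: d => -[] /=; lia. Qed.

Lemma lattice_on_segment (a u : point) (k t : nat) : (0 < k)%N -> (t <= k)%N ->
  on_segment a (a + u *+ k) (to_plane R (a + u *+ t)).
Proof.
move=> k0 tk; exists (t%:R / k%:R).
  by rewrite divr_ge0 ?ler0n // ler_pdivrMr ?ltr0n // mul1r ler_nat.
have kn : k%:R != 0 :> R by rewrite pnatr_eq0 -lt0n.
rewrite /to_plane !point_muln /= !rmorphD /= !rmorphMn /=.
have H (x y : R) : x + y *+ t = (1 - t%:R / k%:R) * x + t%:R / k%:R * (x + y *+ k).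
  by rewrite -(mulr_natr y t) -(mulr_natr y k); field.
by congr pair; apply: H.
Qed.

Lemma level_take_dir s i : (forall j, `|level (take j s)| <= 2) ->
  (i <= size s)%N -> heading East s i = level_dir (level (take i s)).
Proof.
move=> small is_; have [z] := level_heading (take i s).
have -> : heading East (take i s) (size (take i s)) = heading East s i.
  by rewrite /heading take_size.
move=> e.
have := small i; rewrite e /level_dir.
by move=> /abs_le2 /or4P[|||/orP[]] /eqP em; rewrite em /=; move: em; case: heading => //=; lia.
Qed.

(** Otherwise all levels stay between -2 and 2, and the chain, cut into unit steps and truncated, is
    a walk excluded by [parity_obstruction]. *)
Lemma reachable_wide s a : a < 0 -> reachable R s (a, 0) -> wide s.
Proof.
move=> a0 [v [sv v0 st simple] lv]; apply: contrapT => nw.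
have small i : `|level (take i s)| <= 2.
  by rewrite leNgt; apply/negP => h; apply: nw; exists i; lia.
pose V : nat -> point := nth 0 v; pose n := size s.
pose u i : point := unit_vector (heading East s i).
have [len lenP] : exists len : nat -> nat, forall i, (i <= n)%N ->
    (0 < len i)%N /\ V i.+1 = V i + u i *+ len i.
  have H i : exists k : nat, (i <= n)%N -> (0 < k)%N /\ V i.+1 = V i + u i *+ k.
    have [hi|hi] := leqP i n; last by exists 0%N.
    by have [k k0 hk] := st i hi; exists k; rewrite /V hk /u nth_directions.
  by have [len hl] := choice H; exists len.
(* A position is a segment with an offset along it; the far end of a segment counts as offset 0 of
   the next one. *)
pose next (x : nat * nat) :=
  if (x.2.+1 < len x.1)%N then (x.1, x.2.+1) else (x.1.+1, 0%N).
pose pos m := iter m next (0%N, 0%N).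
pose before (x y : nat * nat) := (x.1 < y.1)%N || (x.1 == y.1) && (x.2 < y.2)%N.
have before_next x : before x (next x) by rewrite /before /next; case: ifP => /=; lia.
have before_pos m m' : (m < m')%N -> before (pos m) (pos m').
  elim: m' => // m' IH; rewrite ltnS leq_eqVlt => /orP[/eqP ->|/IH h].
    exact: before_next.
  have : before (pos m') (pos m'.+1) by apply: before_next.
  move: h; rewrite /before; move: (pos m) (pos m') (pos m'.+1) => x y z; lia.
have offset m : ((pos m).1 <= n)%N -> ((pos m).2 < len (pos m).1)%N.
  case: m => [|m]; first by have [] := lenP 0%N isT.
  rewrite [pos m.+1]/(next (pos m)) /next; case: ifP => //= _ h.
  by have [] := lenP _ h.
have visit i : (i <= n.+1)%N -> exists m, pos m = (i, 0%N).
  elim: i => [|i IH] hi; first by exists 0%N.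
  have [|m hm] := IH; first exact: ltnW.
  have [l0 _] := lenP i hi.
  have H t : (t < len i)%N -> pos (m + t)%N = (i, t).
    elim: t => [|t IHt] ht; first by rewrite addn0.
    by rewrite addnS [pos _.+1]/(next (pos (m + t)%N)) (IHt (ltnW ht)) /next /= ht.
  exists (m + (len i).-1)%N.+1.
  by rewrite [pos _.+1]/(next (pos _)) H /next /= ?prednK ?ltnn.
have [M hM] := visit n.+1 (leqnn _).
have early m : (m < M)%N -> ((pos m).1 <= n)%N.
  by move=> /before_pos; rewrite hM /before /=; lia.
pose P m : point := V (pos m).1 + u (pos m).1 *+ (pos m).2.
have PM : P M = (a, 0).
  by rewrite /P hM mulr0n addr0 /V -lv (last_nth 0) sv /n.
have P0 : P 0%N = 0 by rewrite /P /= /V v0 mulr0n addr0.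
have PS m : (m < M)%N -> P m.+1 = P m + u (pos m).1.
  move=> hm; have [l0 hl] := lenP _ (early _ hm); have := offset m (early _ hm).
  rewrite /P [pos m.+1]/(next (pos m)) /next; case: ifP => [h _|h h'] /=.
    by rewrite mulrSr addrA.
  have e : len (pos m).1 = (pos m).2.+1 by lia.
  by rewrite hl mulr0n addr0 e mulrSr addrA.
have seg m : (m < M)%N -> on_segment (V (pos m).1) (V (pos m).1.+1) (to_plane R (P m)).
  move=> hm; have [l0 hl] := lenP _ (early _ hm); have := offset m (early _ hm).
  by move=> h; rewrite hl; apply: lattice_on_segment => //; apply: ltnW.
have seg_end : on_segment (V n) (V n.+1) (to_plane R (V n.+1)).
  by have [l0 hl] := lenP _ (leqnn n); rewrite hl; apply: lattice_on_segment.
(* The far end is the only point that a segment may share with a later one, so this rules out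
   repeated points. *)
have not_end m : (m < M)%N -> P m <> V (pos m).1.+1.
  move=> hm; have [l0 hl] := lenP _ (early _ hm); have := offset m (early _ hm).
  by rewrite hl /P => h /addrI/unit_vectorM_inj e; move: h; rewrite e ltnn.
have inj m m' : (m < m')%N -> (m' <= M)%N -> P m <> P m'.
  move=> mm'; rewrite leq_eqVlt => /orP[/eqP em|m'M] e.
    (* The final position belongs to no segment by its index [n.+1], so the endpoint is treated as a
       point of segment [n]. *)
    rewrite em in mm' e; have hm := early _ mm'.
    have eM : P M = V n.+1 by rewrite /P hM mulr0n addr0.
    have [i_n|i_n] := eqVneq (pos m).1 n.
      by apply: (not_end m mm'); rewrite e eM i_n.
    have [|||nE] := simple (pos m).1 n (to_plane R (P m)) _ _ (seg m mm').
    - by have := early _ mm'; lia.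
    - by rewrite sv.
    - by rewrite e eM.
    move=> /to_plane_inj; rewrite -/(V n) e eM.
    have [l0 ->] := lenP n (leqnn n); rewrite -{2}[V n]addr0 => /addrI.
    rewrite -(mulr0n (u n)) => /unit_vectorM_inj e0; by rewrite e0 in l0.
  have mM : (m < M)%N by apply: ltn_trans m'M.
  have := before_pos _ _ mm'; rewrite /before => /orP[h|/andP[/eqP h h2]]; last first.
    move: e; rewrite /P h => /addrI/unit_vectorM_inj e.
    by rewrite e ltnn in h2.
  have [||i_m] := simple (pos m).1 (pos m').1 (to_plane R (P m)) h _ (seg m mM).
  - by rewrite sv; have := early _ m'M; rewrite /n; lia.
  - by rewrite e; apply: seg.
  by move=> /to_plane_inj; rewrite i_m; apply: not_end.
(* The point of the chain on the open negative axis that is closest to the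
   origin sees the origin along the axis. *)
pose good m := ((P m).2 == 0) && ((P m).1 < 0).
have goodM : good M by rewrite /good PM /= a0.
have [N [NM gN closest]] : exists N, [/\ (N <= M)%N, good N &
    forall m, (m <= M)%N -> good m -> (P m).1 <= (P N).1].
  pose g (i : 'I_M.+1) := good i.
  have gM : g ord_max by [].
  case: (arg_minnP (fun i : 'I_M.+1 => `|(P i).1|%N) gM) => i gi hi.
  exists i; split=> //; first by rewrite -ltnS.
  move=> m mM gm; have := hi (Ordinal (mM : (m < M.+1)%N)) gm.
  by move: gm gi; rewrite /g /good /=; lia.
have small_heading m : (m < M)%N ->
    u (pos m).1 = unit_vector (level_dir (level (take (pos m).1 s))).
  by move=> hm; rewrite /u level_take_dir //; apply: early.
apply: (@parity_obstruction N P (fun m => level (take (pos m).1 s)) (P N).1) => //.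
- by move: gN => /andP[/eqP e _]; rewrite {1}(surjective_pairing (P N)) e.
- by case/andP: gN.
- by move=> i hi; rewrite PS ?small_heading //; apply: leq_trans hi NM.
- move=> i hi; have hiM : (i.+1 < M)%N by apply: leq_trans NM.
  have hS := early _ hiM.
  move: hS; rewrite [pos i.+1]/(next (pos i)) /next; case: ifP => /= _ hS.
    by rewrite subrr normr0.
  rewrite (take_nth Lturn) // level_rcons; case: nth; lia.
- by rewrite /= take0.
- by move=> i j ij jN; apply: inj => //; apply: leq_trans NM.
- move=> i i0 iN; apply/negP => /and3P[/eqP r1 r2 r3].
  have iM : (i < M)%N by apply: leq_trans NM.
  have i0' := inj 0%N i i0 (ltnW iM); have iN' := inj i N iN NM.
  have [x0|x0] := eqVneq (P i).1 0.
    by apply: i0'; rewrite P0 (surjective_pairing (P i)) r1 x0.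
  have gi : good i by rewrite /good r1 eqxx /= lt_neqAle x0 r3.
  have := closest i (ltnW iM) gi => c.
  apply: iN'; rewrite (surjective_pairing (P i)) (surjective_pairing (P N)) r1.
  by have /andP[/eqP -> _] := gN; congr pair; apply/eqP; rewrite eq_le c r2.
Qed.

End RealPlane.

End TurnSequences.

(** * The bounds for all values of the level *)

Theorem theorem9 (R : realType) (s : seq turn) (l r : nat)
  (hl : l = count_mem Lturn s) (hr : r = count_mem Rturn s)
  (hlr : (r <= l)%N)
  (hreach : exists a : int, reachable_negx R s a) :
  [/\ (l - r = 0)%N -> (`|x_minus R s| <= 2)%N,
      (l - r = 1)%N -> (`|x_minus R s| <= staircase_north s + 1)%N,
      (l - r = 2)%N ->
        (last Lturn s = Rturn -> (`|x_minus R s| <= 2)%N) /\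
        (last Lturn s = Lturn -> (`|x_minus R s| <= staircase_north s + 2)%N)
    & (3 <= l - r)%N ->
        (last Lturn s = Rturn /\ l - r = 2 %[mod 4] ->
           (`|x_minus R s| <= (l - r + 2) %/ 4 + 1)%N) /\
        (~ (last Lturn s = Rturn /\ l - r = 2 %[mod 4]) ->
           (`|x_minus R s| <= (l - r + 2) %/ 4)%N)].
Proof.
have ws : wide s by case: hreach => a [a0 ha]; apply: reachable_wide a0 ha.
have lev : level s = Posz (l - r) by rewrite /level; lia.
move: (l - r)%N lev => m lev {l r hl hr hlr hreach}; split.
- by move=> m0; apply: reaches_x_minus => //; apply: reaches_level0; rewrite // lev m0.
- move=> m1; have [|k [k0 hk]] := @reaches_level1 s _ ws; first by rewrite lev m1.
  by move/(reaches_x_minus R k0) => h; apply: leq_trans h hk.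
(* A word of nonzero level is nonempty, so the default [Lturn] of [last] never decides a case. *)
- move=> m2; case/lastP: s ws lev => [|s t] ws lev; first by move: lev; rewrite m2.
  rewrite last_rcons; split=> et; subst t m.
    by apply: reaches_x_minus => //; apply: reaches_level2R.
  have [|k [k0 hk]] := reaches_level2 lev; first by apply: wide_rcons ws _; rewrite lev.
  by move/(reaches_x_minus R k0) => h; apply: leq_trans h hk.
move=> m3; case/lastP: s ws lev => [|s t] ws lev.
  by move: lev; rewrite /level /=; lia.
rewrite last_rcons; have [m2|m2] := eqVneq (m %% 4)%N 2.
  have := reaches_around2 lev m3 m2 => /(reaches_x_minus R) h.
  split=> [[et _]|ne].
    by move: h; rewrite et; apply; lia.
  case: t lev ne h {ws} => [_ _|_ []]; last by split=> //; rewrite m2.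
  by rewrite addn0; apply; lia.
split=> [[_ e]|_]; first by move: m2; rewrite e.
by apply: reaches_x_minus (reaches_around lev m3 m2); lia.
Qed.
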